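(* Let $n$ be a positive integer. There does not exist a choice of a nondegenerate real symmetric $2n\times 2n$ matrix $E$ (which determines the embedding $\iota:\operatorname{SO}_{2n}\hookrightarrow SL_{2n}$, where $\operatorname{SO}_{2n}=\{A\in SL_{2n}(\mathbb R): A^tEA=E\}$), a pinning $(T^D,B_+^D,B_-^D,\{x_i^D\}_{i\in I},\{y_i^D\}_{i\in I})$ of $\operatorname{SO}_{2n}$, and a map $\psi:I\to\{\text{nonempty sequences in }[2n-1]\}$ satisfying the following condition ($\dagger1$): for every $i\in I$, one has $\dot s_i^D=\dot{\mathbf s}^A_{\psi(i)}$ and $y_i^D(a)=\mathbf y^A_{\psi(i)}(f_1(a),\dots,f_{|\psi(i)|}(a))$ for some sequence $(f_1,\dots,f_{|\psi(i)|})$ of differentiable functions $f_j:\mathbb R\to\mathbb R$ with $f_j(\mathbb R_{>0})\subseteq\mathbb R_{>0}$, and similarly for $x_i^D$ (in terms of $\mathbf x^A_{\psi(i)}$) and $\chi_i^D$ (in terms of $\boldsymbol\chi^A_{\psi(i)}$).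
   Context: Notation: $[m]=\{1,\dots,m\}$. Pinning of a connected reductive $\mathbb R$-split linear algebraic group $G$: a split maximal torus $T$, opposite Borel subgroups $B_\pm$ with $B_+\cap B_-=T$ and unipotent radicals $U_\pm$, simple roots $\{\alpha_i\}_{i\in I}$, and homomorphisms $\phi_i:SL_2\to G$ ($i\in I$) whose differential sends $\left[\begin{smallmatrix}0&1\\0&0\end{smallmatrix}\right]$ to a generator of the $\alpha_i$-root space (equivalently, a choice of Chevalley generators). Put $x_i(m)=\phi_i\left[\begin{smallmatrix}1&m\\0&1\end{smallmatrix}\right]\in U_+$, $y_i(m)=\phi_i\left[\begin{smallmatrix}1&0\\ m&1\end{smallmatrix}\right]\in U_-$, $\chi_i(t)=\phi_i\left[\begin{smallmatrix}t&0\\0&t^{-1}\end{smallmatrix}\right]\in T$, $\dot s_i=\phi_i\left[\begin{smallmatrix}0&-1\\1&0\end{smallmatrix}\right]$. For a sequence $\mathbf i=(i_1,\dots,i_\ell)$ put $|\mathbf i|=\ell$, $\dot{\mathbf s}_{\mathbf i}=\dot s_{i_1}\cdots\dot s_{i_\ell}$, $\mathbf y_{\mathbf i}(a_1,\dots,a_\ell)=y_{i_1}(a_1)\cdots y_{i_\ell}(a_\ell)$, and similarly $\mathbf x_{\mathbf i}$, $\boldsymbol\chi_{\mathbf i}$. Superscripts $D$ refer to $\operatorname{SO}_{2n}$, and superscripts $A$ to $GL_{2n}$ with its standard pinning: $T^A$ diagonal, $B_\pm^A$ upper/lower triangular, and $\phi_i^A$ ($i\in[2n-1]$) placing a $2\times2$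 matrix in rows and columns $i,i+1$ of the identity matrix. Elements of $\operatorname{SO}_{2n}$ are regarded as elements of $SL_{2n}\subset GL_{2n}$ via $\iota$.
   Formalization: The index set I of simple roots is additionally assumed nonempty: for n = 1 and split E, SO_2 is a torus with I empty, so (†1) holds vacuously and the claim fails; for n ≥ 2 the assumption is automatic. *)

(* Defs.v *)
From HB Require Import structures.
From mathcomp Require Import all_boot all_order all_algebra.
From mathcomp Require Import all_classical all_reals all_analysis.
From mathcomp.real_closed Require Import complex.
(* The notations of mpoly clash with those of MathComp-Analysis. *)
From mathcomp.multinomials Require mpoly.
Import -(notations) mpoly.

Set Implicit Arguments.
Unset Strict Implicit.
Unset Printing Implicit Defensive.

Import Order.TTheory GRing.Theory Num.Theory.
Import numFieldNormedType.Exports.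

Local Open Scope classical_set_scope.
Local Open Scope ring_scope.

(* Polynomials in the entries of an N x N matrix: the entry A i j is the
   variable numbered mxvec_index i j. *)
Definition mxpolys (k : nzRingType) (N : nat) : Type := mpoly (N * N) k.

Section PolynomialFunctions.
Context (k : nzRingType) (K : comNzRingType) (f : {rmorphism k -> K}) (N : nat).

(* p(A), the coefficients being sent to K by f *)
Definition mxpoly_eval (p : mxpolys k N) (A : 'M[K]_N) : K :=
  mmap f (fun v => mxvec A 0 v) p.

(* d_A p(X), the directional derivative of p at A along X *)
Definition mxpoly_diff (p : mxpolys k N) (A X : 'M[K]_N) : K :=
  \sum_(v < N * N) mmap f (fun w => mxvec A 0 w) (mderiv v p) * mxvec X 0 v.

Definition polymx_eval M (F : 'M[mxpolys k N]_M) (A : 'M[K]_N) : 'M[K]_M :=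
  map_mx (mxpoly_eval^~ A) F.

Definition polymx_diff M (F : 'M[mxpolys k N]_M) (A X : 'M[K]_N) : 'M[K]_M :=
  map_mx (fun p => mxpoly_diff p A X) F.

End PolynomialFunctions.

Section MatrixGroups.
Context (K : fieldType) (N : nat).
Implicit Types (S H U : set 'M[K]_N) (A B : 'M[K]_N).

Definition mx_subgroup S : Prop :=
  [/\ S `<=` [set A | A \in unitmx], S 1%:M,
      (forall A B, S A -> S B -> S (A *m B)) &
      (forall A, S A -> S (invmx A))].

Definition mx_normal S H : Prop :=
  S `<=` H /\ forall A B, S A -> H B -> S (B *m A *m invmx B).

(* the subgroup generated by the commutators of S *)
Definition mx_derived S : set 'M[K]_N :=
  [set A | forall H, mx_subgroup H ->
     (forall B C, S B -> S C -> H (B *m C *m invmx B *m invmx C)) -> H A].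

Definition mx_solvable S : Prop :=
  exists m : nat, iter m mx_derived S `<=` [set 1%:M].

Definition mx_unipotent A : Prop := exists m : nat, (A - 1%:M) ^+ m = 0.

(* S is the zero locus, in GL_N(K), of a set of polynomials with coefficients
   in k; for a perfect k and an algebraically closed K, this is what it means
   for a closed subset of GL_N to be defined over k. *)
Definition zclosed_over (k : nzRingType) (f : {rmorphism k -> K}) S : Prop :=
  exists P : set (mxpolys k N),
    S = [set A | A \in unitmx /\ forall p, P p -> mxpoly_eval f p A = 0].

Definition zclosed S : Prop := zclosed_over idfun S.

Definition zconnected S : Prop :=
  S !=set0 /\ forall S1 S2, zclosed S1 -> zclosed S2 ->
    S = S1 `|` S2 -> S1 `&` S2 = set0 -> S1 = set0 \/ S2 = set0.

Definition zconnected_subgroup S : Prop :=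
  [/\ mx_subgroup S, zclosed S & zconnected S].

(* The Lie algebra of a closed subgroup of GL_N(K), as the tangent space at 1:
   all the equations of S hold to first order along X. *)
Definition mx_Lie S : set 'M[K]_N :=
  [set X | forall p : mxpolys K N, (forall A, S A -> mxpoly_eval idfun p A = 0) ->
     mxpoly_diff idfun p 1%:M X = 0].

Definition is_torus S : Prop :=
  zconnected_subgroup S /\
  exists2 Q : 'M[K]_N, Q \in unitmx &
    forall A, S A -> is_diag_mx (Q *m A *m invmx Q).

Definition is_maximal_torus S H : Prop :=
  [/\ S `<=` H, is_torus S &
      forall S', is_torus S' -> S' `<=` H -> S `<=` S' -> S' = S].

Definition is_Borel S H : Prop :=
  [/\ S `<=` H, zconnected_subgroup S, mx_solvable S &
      forall S', zconnected_subgroup S' -> mx_solvable S' ->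
        S' `<=` H -> S `<=` S' -> S' = S].

Definition connected_normal_unipotent S H : Prop :=
  [/\ zconnected_subgroup S, mx_normal S H & S `<=` mx_unipotent].

Definition is_unipotent_radical U H : Prop :=
  connected_normal_unipotent U H /\
  forall S, connected_normal_unipotent S H -> S `<=` U.

(* A character of T is represented by a function on matrices, of which only
   the restriction to T is relevant; a weight of an algebraic representation
   of T is automatically an algebraic character. *)
Definition root_space (T H : set 'M[K]_N) (a : 'M[K]_N -> K) : set 'M[K]_N :=
  [set X | mx_Lie H X /\ forall t, T t -> t *m X *m invmx t = a t *: X].

Definition is_root (T H : set 'M[K]_N) (a : 'M[K]_N -> K) : Prop :=
  (exists2 t, T t & a t != 1) /\ (exists2 X, root_space T H a X & X != 0).

(* The simple roots attached to a Borel subgroup B: the roots of T in B that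
   are not sums (multiplicatively: products) of two roots of T in B. *)
Definition is_simple_root (T B : set 'M[K]_N) (a : 'M[K]_N -> K) : Prop :=
  is_root T B a /\
  ~ exists b c, [/\ is_root T B b, is_root T B c &
                    forall t, T t -> a t = b t * c t].

Definition spans_root_space (T H : set 'M[K]_N) (a : 'M[K]_N -> K)
    (X : 'M[K]_N) : Prop :=
  [/\ root_space T H a X, X != 0 &
      forall Y, root_space T H a Y -> exists c : K, Y = c *: X].

End MatrixGroups.

Section TwoByTwo.
Context (K : fieldType).

Definition mx2 (a b c d : K) : 'M[K]_2 :=
  \matrix_(i < 2, j < 2)
    if i == 0 then (if j == 0 then a else b) else (if j == 0 then c else d).

Definition SL2_x (m : K) : 'M[K]_2 := mx2 1 m 0 1.
Definition SL2_y (m : K) : 'M[K]_2 := mx2 1 0 m 1.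
Definition SL2_chi (t : K) : 'M[K]_2 := mx2 t 0 0 t^-1.
Definition SL2_s : 'M[K]_2 := mx2 0 (-1) 1 0.
Definition sl2_e : 'M[K]_2 := mx2 0 1 0 0.

End TwoByTwo.

Arguments SL2_s {K}.
Arguments sl2_e {K}.

(* The pinnings, with simple roots indexed bijectively by I, of a linear algebraic
   group defined over R, given by the set G of its complex points. Subgroups are
   likewise given by their complex points. *)
Record pinning (R : realType) (N : nat) (G : set 'M[R[i]]_N) (I : finType) := Pinning {
  pin_T : set 'M[R[i]]_N;
  pin_Bp : set 'M[R[i]]_N;
  pin_Bm : set 'M[R[i]]_N;
  pin_Up : set 'M[R[i]]_N;
  pin_Um : set 'M[R[i]]_N;
  pin_root : I -> 'M[R[i]]_N -> R[i];
  (* Since SL_2 is closed in the affine space of 2 x 2 matrices, every morphism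
     of varieties over R from SL_2 to the N x N matrices is given by an N x N
     matrix of real polynomials in the 4 entries. *)
  pin_phi : I -> 'M[mxpolys R 2]_N;
  pin_T_maximal_torus : is_maximal_torus pin_T G;
  pin_T_over_R : zclosed_over (real_complex R) pin_T;
  pin_T_split : exists2 Q : 'M[R]_N, Q \in unitmx &
        forall t, pin_T t ->
          is_diag_mx (map_mx (real_complex R) Q *m t
                        *m invmx (map_mx (real_complex R) Q));
  pin_Bp_Borel : is_Borel pin_Bp G;
  pin_Bm_Borel : is_Borel pin_Bm G;
  pin_Bp_over_R : zclosed_over (real_complex R) pin_Bp;
  pin_Bm_over_R : zclosed_over (real_complex R) pin_Bm;
  pin_BpBm : pin_Bp `&` pin_Bm = pin_T;
  pin_Up_radical : is_unipotent_radical pin_Up pin_Bp;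
  pin_Um_radical : is_unipotent_radical pin_Um pin_Bm;
  pin_root_simple : forall i, is_simple_root pin_T pin_Bp (pin_root i);
  pin_root_inj : forall i j, (forall t, pin_T t -> pin_root i t = pin_root j t) -> i = j;
  pin_root_surj : forall a, is_simple_root pin_T pin_Bp a ->
        exists i, forall t, pin_T t -> a t = pin_root i t;
  pin_phi_in : forall i (A : 'M[R[i]]_2), \det A = 1 ->
        G (polymx_eval (real_complex R) (pin_phi i) A);
  pin_phi_mul : forall i (A B : 'M[R[i]]_2), \det A = 1 -> \det B = 1 ->
        polymx_eval (real_complex R) (pin_phi i) (A *m B) =
        polymx_eval (real_complex R) (pin_phi i) A
          *m polymx_eval (real_complex R) (pin_phi i) B;
  pin_phi_e : forall i, spans_root_space pin_T G (pin_root i)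
        (polymx_diff (real_complex R) (pin_phi i) 1%:M sl2_e);
  pin_xP : forall i m, pin_Up (polymx_eval (real_complex R) (pin_phi i) (SL2_x m));
  pin_yP : forall i m, pin_Um (polymx_eval (real_complex R) (pin_phi i) (SL2_y m));
  pin_chiP : forall i t, t != 0 ->
        pin_T (polymx_eval (real_complex R) (pin_phi i) (SL2_chi t))
}.

Definition phiR (R : realType) (N : nat) (G : set 'M[R[i]]_N) (I : finType)
    (P : pinning G I) (i : I) (A : 'M[R]_2) : 'M[R]_N :=
  polymx_eval idfun (pin_phi P i) A.

(* The complex points of the algebraic group SO(E) over R; its real points are
   the real A such that \det A = 1 and A^T *m E *m A = E. *)
Definition SO (R : realType) (N : nat) (E : 'M[R]_N) : set 'M[R[i]]_N :=
  [set A | \det A = 1 /\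
     A^T *m map_mx (real_complex R) E *m A = map_mx (real_complex R) E].

(* The standard pinning of GL_N: phiA k A is the identity matrix with A placed in
   rows and columns k, k + 1 (k counted from 0). *)
Definition phiA (K : fieldType) (N : nat) (k : 'I_N.-1) (A : 'M[K]_2) : 'M[K]_N :=
  \matrix_(i < N, j < N)
    if ((k <= i <= k.+1) && (k <= j <= k.+1))%N
    then A (inord (i - k)) (inord (j - k)) else (i == j)%:R.

(* phi^A_{s_1}(g(a_1)) ... phi^A_{s_l}(g(a_l)), from left to right; with g one of
   SL2_x, SL2_y, SL2_chi this is x_s(a), y_s(a), chi_s(a) *)
Definition wordA (K : fieldType) (N : nat) (g : K -> 'M[K]_2) (s : seq 'I_N.-1)
    (a : 'I_(size s) -> K) : 'M[K]_N :=
  \big[mulmx/1%:M]_(j < size s) phiA (tnth (in_tuple s) j) (g (a j)).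

Definition sdotA (K : fieldType) (N : nat) (s : seq 'I_N.-1) : 'M[K]_N :=
  \big[mulmx/1%:M]_(k <- s) phiA k SL2_s.

Definition pos_differentiable (R : realType) (D : set R) (f : R -> R) : Prop :=
  (forall a, D a -> derivable f a 1) /\ (forall a, 0 < a -> 0 < f a).

(* The parameters of chi_i live in R \ {0}: there the f_j are functions from
   R \ {0} to itself. *)
Definition dagger1 (R : realType) (N : nat) (G : set 'M[R[i]]_N) (I : finType)
    (P : pinning G I) (psi : I -> seq 'I_N.-1) : Prop :=
  forall i : I,
  [/\ phiR P i SL2_s = sdotA R (psi i),
      exists2 f : 'I_(size (psi i)) -> R -> R,
        forall j, pos_differentiable setT (f j) &
        forall a : R, phiR P i (SL2_y a) = wordA (@SL2_y R) (fun j => f j a),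
      exists2 f : 'I_(size (psi i)) -> R -> R,
        forall j, pos_differentiable setT (f j) &
        forall a : R, phiR P i (SL2_x a) = wordA (@SL2_x R) (fun j => f j a) &
      exists2 f : 'I_(size (psi i)) -> R -> R,
        forall j, pos_differentiable [set t | t != 0] (f j) /\
                  (forall t, t != 0 -> f j t != 0) &
        forall t : R, t != 0 ->
          phiR P i (SL2_chi t) = wordA (@SL2_chi R) (fun j => f j t)].

(* Main.v *)
Require Import Defs.
From HB Require Import structures.
From mathcomp Require Import all_boot all_order all_algebra.
From mathcomp Require Import all_classical all_reals all_analysis.
From mathcomp.real_closed Require Import complex.
From mathcomp Require Import ring zify.
From mathcomp.multinomials Require mpoly.
Import -(notations) mpoly.

Set Implicit Arguments.
Unset Strict Implicit.
Unset Printing Implicit Defensive.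

Import Order.TTheory GRing.Theory Num.Theory.

Local Open Scope classical_set_scope.
Local Open Scope ring_scope.

(** Write N = 2n, and let e_i be the differential of phi_i at the standard nilpotent
    element of sl_2: it spans the root space of the simple root alpha_i.

    Every root vector e of SO_N in the vector representation satisfies e^2 = 0, so that
    x_i(a) = 1 + a e_i and y_i(a) = 1 + a f_i (phiC_x, phiC_y), where the opposite
    vector f_i has weight - alpha_i (pin_f_weight). Suppose that these elements are
    positive words in the elementary matrices of GL_N. Then e_i = x_i(1) - 1 has
    nonnegative entries, with a positive entry at (k, k + 1) for each letter k of
    psi(i), and f_i has the transposed properties. Three facts now contradict each
    other, as N - 1 letters cannot accommodate n disjoint pairs of letters:
    - psi(i) has at least two distinct letters (dagger_two_letters). With a single
      letter, e_i would be a multiple of a matrix unit, whereas E e_i is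
      skew-symmetric and hence not of rank one.
    - psi(i) and psi(j) share no letter when i <> j (dagger_disjoint). A common letter
      makes tr(e_i f_j) positive, but e_i f_j has the nonzero weight
      alpha_i - alpha_j, so its trace is zero.
    - There are at least n simple roots (pin_rank) as soon as n > 1; for n = 1 one simple
      root is enough.

    What the argument needs from the theory of reductive groups is proved directly for
    SO_N. Eigenvectors of the maximal torus T can be chosen to form a hyperbolic basis
    (hyperbolic_basis), so T lies in the group of all diagonal isometries of
    determinant 1, which is a torus, hence is that group. Comparing coordinates on
    this torus gives e^2 = 0 (root_vector_square). Let B be a Borel subgroup
    containing T. The Lie-Kolchin theorem (lie_kolchin), applied successively to the
    quotients W^perp / W, gives a full isotropic flag stable under B; as the torus has
    distinct weights, it consists of coordinate subspaces (stable_flag_step). The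
    stabilizer of this flag is connected and solvable, so B is equal to it
    (Borel_height), and the root vectors of B are explicit matrices, among which the n
    simple ones of type D_n are recognized by the value of a cocharacter
    (simple_roots_count). *)

(** * Polynomial functions of the entries of a matrix *)

Section PolynomialFunctions.
Context (K : comNzRingType) (N : nat).
Implicit Types (f g : 'M[K]_N -> K).

Inductive polyfun : ('M[K]_N -> K) -> Prop :=
| polyfun_const c : polyfun (fun=> c)
| polyfun_entry i j : polyfun (fun A => A i j)
| polyfunD f g : polyfun f -> polyfun g -> polyfun (fun A => f A + g A)
| polyfunM f g : polyfun f -> polyfun g -> polyfun (fun A => f A * g A).

Lemma eq_polyfun f g : f =1 g -> polyfun f -> polyfun g.
Proof. by move=> /funext ->. Qed.

Lemma polyfun_sum (J : Type) (r : seq J) (P : pred J) (F : J -> 'M[K]_N -> K) :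
  (forall j, polyfun (F j)) -> polyfun (fun A => \sum_(j <- r | P j) F j A).
Proof.
move=> hF; elim: r => [|j r IHr].
  by apply: eq_polyfun (polyfun_const 0) => A; rewrite big_nil.
case Pj: (P j).
  by apply: eq_polyfun (polyfunD (hF j) IHr) => A; rewrite big_cons Pj.
by apply: eq_polyfun IHr => A; rewrite big_cons Pj.
Qed.

Lemma polyfun_prod (J : Type) (r : seq J) (P : pred J) (F : J -> 'M[K]_N -> K) :
  (forall j, polyfun (F j)) -> polyfun (fun A => \prod_(j <- r | P j) F j A).
Proof.
move=> hF; elim: r => [|j r IHr].
  by apply: eq_polyfun (polyfun_const 1) => A; rewrite big_nil.
case Pj: (P j).
  by apply: eq_polyfun (polyfunM (hF j) IHr) => A; rewrite big_cons Pj.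
by apply: eq_polyfun IHr => A; rewrite big_cons Pj.
Qed.

Lemma polyfunB f g : polyfun f -> polyfun g -> polyfun (fun A => f A - g A).
Proof.
move=> hf hg; apply: eq_polyfun (polyfunD hf (polyfunM (polyfun_const (-1)) hg)).
by move=> A /=; rewrite mulN1r.
Qed.

Definition polymap m n (F : 'M[K]_N -> 'M[K]_(m, n)) : Prop :=
  forall i j, polyfun (fun A => F A i j).

Lemma polymap_const m n (B : 'M[K]_(m, n)) : polymap (fun=> B).
Proof. by move=> i j; apply: polyfun_const. Qed.

Lemma polymap_id : polymap (fun A => A).
Proof. by move=> i j; apply: polyfun_entry. Qed.

Lemma polymap_mul m n p (F : 'M[K]_N -> 'M[K]_(m, n)) (G : 'M[K]_N -> 'M[K]_(n, p)) :
  polymap F -> polymap G -> polymap (fun A => F A *m G A).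
Proof.
move=> hF hG i j.
apply: (@eq_polyfun (fun A => \sum_k F A i k * G A k j)) => [A|].
  by rewrite mxE.
by apply: polyfun_sum => k; apply: polyfunM.
Qed.

Lemma polymapB m n (F G : 'M[K]_N -> 'M[K]_(m, n)) :
  polymap F -> polymap G -> polymap (fun A => F A - G A).
Proof.
move=> hF hG i j; apply: eq_polyfun (polyfunB (hF i j) (hG i j)) => A.
by rewrite !mxE.
Qed.

Lemma polymap_tr m n (F : 'M[K]_N -> 'M[K]_(m, n)) :
  polymap F -> polymap (fun A => (F A)^T).
Proof. by move=> hF i j; apply: eq_polyfun (hF j i) => A; rewrite mxE. Qed.

Lemma polyfun_det m (F : 'M[K]_N -> 'M[K]_m) :
  polymap F -> polyfun (fun A => \det (F A)).
Proof.
move=> hF; apply: polyfun_sum => s; apply: polyfunM; first exact: polyfun_const.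
by apply: polyfun_prod => i; apply: hF.
Qed.

Lemma polymap_adj m (F : 'M[K]_N -> 'M[K]_m) :
  polymap F -> polymap (fun A => \adj (F A)).
Proof.
move=> hF i j.
apply: (@eq_polyfun (fun A => (-1) ^+ (j + i) * \det (row' j (col' i (F A))))).
  by move=> A; rewrite mxE.
apply: polyfunM; first exact: polyfun_const.
apply: polyfun_det => k l.
by apply: eq_polyfun (hF (lift j k) (lift i l)) => A; rewrite !mxE.
Qed.

End PolynomialFunctions.

Lemma polyfun_comp (K : comNzRingType) (N d : nat) (f : 'M[K]_d -> K)
    (F : 'M[K]_N -> 'M[K]_d) :
  polyfun f -> polymap F -> polyfun (fun A => f (F A)).
Proof.
move=> hf hF; elim: hf => {f} [c|i j|f g _ hf _ hg|f g _ hf _ hg].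
- exact: polyfun_const.
- exact: hF.
- exact: polyfunD.
- exact: polyfunM.
Qed.

Lemma mpoly_closure (n : nat) (k : nzRingType) (P : mpoly n k -> Prop) :
  (forall c, P (mpolyC n c)) -> (forall i, P (mpolyX k (mnm1 i))) ->
  (forall p q, P p -> P q -> P (p + q)) -> (forall p q, P p -> P q -> P (p * q)) ->
  forall p, P p.
Proof.
move=> PC PX PD PM p; rewrite (mpolyE p); elim: (msupp p) => [|m r IHr].
  by rewrite big_nil -(mpolyC0 n); apply: PC.
rewrite big_cons; apply: PD => //; rewrite -mul_mpolyC; apply: (PM) => //.
rewrite mpolyXE_id; elim/big_ind: _ => //= [|i _].
  by rewrite -mpolyC1; apply: PC.
elim: (m i) => [|l IHl]; first by rewrite expr0 -mpolyC1; apply: PC.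
by rewrite exprS; apply: PM.
Qed.

Section Evaluation.
Context (k : nzRingType) (K : comNzRingType) (f : {rmorphism k -> K}) (N : nat).
Implicit Types (p q : mxpolys k N) (A X : 'M[K]_N).

Lemma mxpoly_evalC c A : mxpoly_eval f (mpolyC _ c) A = f c.
Proof. exact: mmapC. Qed.

Lemma mxpoly_evalX i j A : mxpoly_eval f (mpolyX k (mnm1 (mxvec_index i j))) A = A i j.
Proof. by rewrite /mxpoly_eval mmapX mmap1U mxvecE. Qed.

Lemma mxpoly_evalD p q A : mxpoly_eval f (p + q) A = mxpoly_eval f p A + mxpoly_eval f q A.
Proof. exact: mmapD. Qed.

Lemma mxpoly_evalM p q A : mxpoly_eval f (p * q) A = mxpoly_eval f p A * mxpoly_eval f q A.
Proof. exact: rmorphM. Qed.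

Lemma mxpoly_diffC c A X : mxpoly_diff f (mpolyC _ c) A X = 0.
Proof.
by rewrite /mxpoly_diff big1 // => v _; rewrite mderivC mmap0 mul0r.
Qed.

Lemma mxpoly_diffX i j A X :
  mxpoly_diff f (mpolyX k (mnm1 (mxvec_index i j))) A X = X i j.
Proof.
rewrite /mxpoly_diff (bigD1 (mxvec_index i j)) //= mxvecE big1 => [|v nv].
  rewrite addr0 mderivX mmapZ mmapX mnm1E eqxx rmorph1 mul1r.
  have -> : (mnm_sub (mnm1 (mxvec_index i j)) (mnm1 (mxvec_index i j))) = mnm0.
    by apply/mnmP => w; rewrite mnmBE mnm0E subnn.
  by rewrite mmap11 mul1r.
by rewrite mderivX mnm1E eq_sym (negbTE nv) scale0r mmap0 mul0r.
Qed.

Lemma mxpoly_diffD p q A X :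
  mxpoly_diff f (p + q) A X = mxpoly_diff f p A X + mxpoly_diff f q A X.
Proof.
by rewrite /mxpoly_diff -big_split /=; apply: eq_bigr => v _; rewrite mderivD mmapD mulrDl.
Qed.

Lemma mxpoly_diffM p q A X :
  mxpoly_diff f (p * q) A X =
  mxpoly_diff f p A X * mxpoly_eval f q A + mxpoly_eval f p A * mxpoly_diff f q A X.
Proof.
rewrite /mxpoly_diff mulr_suml mulr_sumr -big_split /=; apply: eq_bigr => v _.
rewrite mderivM mmapD mulrDl; congr (_ + _); last by rewrite rmorphM mulrA.
by rewrite rmorphM mulrAC.
Qed.

Lemma mxpolys_closure (P : mxpolys k N -> Prop) :
  (forall c, P (mpolyC _ c)) -> (forall i j, P (mpolyX k (mnm1 (mxvec_index i j)))) ->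
  (forall p q, P p -> P q -> P (p + q)) -> (forall p q, P p -> P q -> P (p * q)) ->
  forall p, P p.
Proof.
move=> PC PX PD PM; apply: mpoly_closure => // v.
by case/mxvec_indexP: v.
Qed.

Lemma polyfun_eval p : polyfun (mxpoly_eval f p).
Proof.
elim/mxpolys_closure: p => [c|i j|p q hp hq|p q hp hq].
- by apply: eq_polyfun (polyfun_const _ (f c)) => A; rewrite mxpoly_evalC.
- by apply: eq_polyfun (polyfun_entry _ i j) => A; rewrite mxpoly_evalX.
- by apply: eq_polyfun (polyfunD hp hq) => A; rewrite mxpoly_evalD.
- by apply: eq_polyfun (polyfunM hp hq) => A; rewrite mxpoly_evalM.
Qed.

(** The formal derivative mxpoly_diff is tied to the values of p by this expansion, from
    which all the tangent vectors below are computed. *)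
Lemma mxpoly_taylor1 p A X : exists q : {poly K}, forall s,
  mxpoly_eval f p (A + s *: X) =
  mxpoly_eval f p A + s * mxpoly_diff f p A X + s ^+ 2 * q.[s].
Proof.
elim/mxpolys_closure: p => [c|i j|p p' [q hq] [q' hq']|p p' [q hq] [q' hq']].
- by exists 0 => s; rewrite !mxpoly_evalC mxpoly_diffC horner0 !mulr0 !addr0.
- by exists 0 => s; rewrite !mxpoly_evalX mxpoly_diffX horner0 mulr0 addr0 !mxE.
- exists (q + q') => s; rewrite !mxpoly_evalD mxpoly_diffD hq hq' hornerD; ring.
- exists (q * (mxpoly_eval f p' A)%:P + q' * (mxpoly_eval f p A)%:P
     + (mxpoly_diff f p A X * mxpoly_diff f p' A X)%:P
     + 'X * (q * (mxpoly_diff f p' A X)%:P + q' * (mxpoly_diff f p A X)%:P)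
     + 'X^2 * q * q') => s.
  by rewrite !mxpoly_evalM mxpoly_diffM hq hq' !hornerE; ring.
Qed.

End Evaluation.

Lemma polyfunP (K : comNzRingType) N (g : 'M[K]_N -> K) :
  polyfun g -> exists p : mxpolys K N, forall A, mxpoly_eval idfun p A = g A.
Proof.
elim=> {g} [c|i j|f g _ [p hp] _ [q hq]|f g _ [p hp] _ [q hq]].
- by exists (mpolyC _ c) => A; rewrite mxpoly_evalC.
- by exists (mpolyX K (mnm1 (mxvec_index i j))) => A; rewrite mxpoly_evalX.
- by exists (p + q) => A; rewrite mxpoly_evalD hp hq.
- by exists (p * q) => A; rewrite mxpoly_evalM hp hq.
Qed.

Lemma mxpoly_eval_map (k : nzRingType) (K : comNzRingType) (k' : comNzRingType)
    (g : {rmorphism k -> k'}) (f : {rmorphism k' -> K}) (h : {rmorphism k -> K}) N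
    (p : mxpolys k N) (A : 'M[k']_N) :
  (forall c, h c = f (g c)) ->
  mxpoly_eval h p (map_mx f A) = f (mxpoly_eval g p A).
Proof.
move=> hfg; elim/mxpolys_closure: p => [c|i j|p q hp hq|p q hp hq].
- by rewrite !mxpoly_evalC.
- by rewrite !mxpoly_evalX mxE.
- by rewrite !mxpoly_evalD hp hq rmorphD.
- by rewrite !mxpoly_evalM hp hq rmorphM.
Qed.

(** * Zariski closed and connected sets of matrices *)

Section ZariskiClosed.
Context (K : fieldType) (N : nat).
Implicit Types (S : set 'M[K]_N) (A B : 'M[K]_N).

(** Closed sets can be handled through polynomial functions instead of polynomials. *)
Lemma zclosedP S : zclosed S <-> exists F : set ('M[K]_N -> K),
  F `<=` @polyfun K N /\ S = [set A | A \in unitmx /\ forall f, F f -> f A = 0].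
Proof.
split=> [[P ->]|[F [hF ->]]].
  exists [set mxpoly_eval idfun p | p in P]; split.
    by move=> _ [p _ <-]; apply: polyfun_eval.
  apply/seteqP; split=> A [uA hA]; split=> //.
    by move=> _ [p Pp <-]; apply: hA.
  by move=> p Pp; apply: hA; exists p.
exists [set p | F (mxpoly_eval idfun p)].
apply/seteqP; split=> A [uA hA]; split=> //.
  by move=> p /= Fp; apply: hA.
move=> f Ff.
have [p hp] := polyfunP (hF _ Ff).
by rewrite -hp; apply: hA => /=; rewrite (_ : mxpoly_eval _ p = f) //; apply/funext.
Qed.

Lemma zclosed_unit S A : zclosed S -> S A -> A \in unitmx.
Proof. by case=> P -> []. Qed.

Lemma zclosed_sep S A : zclosed S -> A \in unitmx -> ~ S A ->
  exists2 f, polyfun f & (forall B, S B -> f B = 0) /\ f A != 0.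
Proof.
move=> /zclosedP [F [hF ->]] uA /= nSA; apply: contrapT => nf; apply: nSA.
split=> // f Ff; apply/eqP/negPn/negP => nz; apply: nf; exists f; first exact: hF.
by split=> // B [_]; apply.
Qed.

Lemma zclosed_cap S f : zclosed S -> polyfun f -> zclosed [set A | S A /\ f A = 0].
Proof.
move=> /zclosedP [F [hF ->]] hf; apply/zclosedP; exists [set g | F g \/ g = f]; split.
  by move=> g [/hF//|->].
apply/seteqP; split=> A /=.
  by case=> [[uA hA] fA]; split=> // g [/hA|->].
case=> uA hA; split; last by apply: hA; right.
by split=> // g Fg; apply: hA; left.
Qed.

End ZariskiClosed.

(** The only consequence of connectedness that representation theory needs; unlike
    zconnected, it passes to derived groups without knowing that they are closed. *)
Definition finite_values_constant (K : fieldType) N (S : set 'M[K]_N) : Prop :=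
  forall f (c : seq K), polyfun f -> (forall A, S A -> f A \in c) ->
  forall A B, S A -> S B -> f A = f B.

(** The fibre of f over one of its values and the union of the other fibres are closed. *)
Lemma zconnected_values (K : fieldType) N (S : set 'M[K]_N) :
  zclosed S -> zconnected S -> finite_values_constant S.
Proof.
move=> clS [_ conS] f c hf hc A B SA SB.
have pf1 : polyfun (fun X => f X - f B).
  by apply: polyfunB => //; apply: polyfun_const.
pose g X := \prod_(x <- c | x != f B) (f X - x).
have pf2 : polyfun g.
  by apply: polyfun_prod => x; apply: polyfunB => //; apply: polyfun_const.
have [||S0|S0] := conS _ _ (zclosed_cap clS pf1) (zclosed_cap clS pf2).
- apply/seteqP; split=> X /=; last by case=> -[].
  move=> SX; have [e|ne] := eqVneq (f X) (f B); first by left; rewrite e subrr.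
  right; split=> //; rewrite /g (big_rem (f X)) ?hc //= ne subrr mul0r //.
- rewrite -subset0 => X [[SX e] [_ /eqP]]; rewrite /g prodf_seq_eq0 => /hasP[x _ /andP[nx]].
  by rewrite subr_eq0 => /eqP ex; move: nx; rewrite -ex -subr_eq0 e eqxx.
- have : [set X | S X /\ f X - f B = 0] B by split=> //; rewrite subrr.
  by rewrite S0.
- apply/eqP/negPn/negP => ne.
  have : [set X | S X /\ g X = 0] A.
    by split=> //; rewrite /g (big_rem (f A)) ?hc //= ne subrr mul0r.
  by rewrite S0.
Qed.

(** * Curves in matrix space *)

Lemma poly_fun_eq0 (K : numDomainType) (q : {poly K}) : (forall s, q.[s] = 0) -> q = 0.
Proof.
move=> hq; apply/eqP/negPn/negP => nz.
have := @max_poly_roots K q [seq i%:R | i <- iota 0 (size q)] nz.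
rewrite size_map size_iota ltnn => H; suff: false by []; apply: H.
  by apply/allP => x _; rewrite /root hq.
by rewrite map_inj_uniq ?iota_uniq // => x y /eqP; rewrite eqr_nat => /eqP.
Qed.

Lemma poly_fun_eq (K : numDomainType) (p q : {poly K}) :
  (forall s, p.[s] = q.[s]) -> p = q.
Proof.
move=> h; apply/eqP; rewrite -subr_eq0; apply/eqP/poly_fun_eq0 => s.
by rewrite hornerD hornerN h subrr.
Qed.

(** The rational functions of s with denominator a power of d; inversion being total,
    nothing can be asked at the zeros of d. *)
Definition ratfun (K : fieldType) (d : {poly K}) (g : K -> K) : Prop :=
  exists k (q : {poly K}), forall s, d.[s] != 0 -> d.[s] ^+ k * g s = q.[s].

Section Curves.
Context (K : numFieldType) (N : nat).
Implicit Types (d : {poly K}).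

Lemma polyfun_ratcurve d (gam : K -> 'M[K]_N) f :
  (forall i j, ratfun d (fun s => gam s i j)) -> polyfun f -> ratfun d (f \o gam).
Proof.
move=> hg; elim=> {f} [c|i j|f g _ [k [p hp]] _ [l [q hq]]|f g _ [k [p hp]] _ [l [q hq]]].
- by exists 0%N, c%:P => s _ /=; rewrite expr0 mul1r hornerC.
- exact: hg.
- exists (k + l)%N, (p * d ^+ l + q * d ^+ k) => s ds /=.
  rewrite !hornerE -hp // -hq // exprD /=; ring.
- exists (k + l)%N, (p * q) => s ds /=.
  rewrite !hornerE -hp // -hq // exprD /=; ring.
Qed.

Lemma polyfun_curve (gam : K -> 'M[K]_N) (q : 'I_N -> 'I_N -> {poly K}) f :
  (forall s i j, gam s i j = (q i j).[s]) -> polyfun f ->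
  exists r : {poly K}, forall s, f (gam s) = r.[s].
Proof.
move=> hq hf; have [|k [r hr]] := @polyfun_ratcurve 1 gam f _ hf.
  by move=> i j; exists 0%N, (q i j) => s _; rewrite expr0 mul1r hq.
by exists r => s; rewrite -hr hornerC ?oner_eq0 // expr1n mul1r.
Qed.

(** The roles of S1 and S2 can be exchanged, so this one-sided condition is symmetric. *)
Definition zlinked (S : set 'M[K]_N) A B : Prop :=
  forall S1 S2, zclosed S1 -> zclosed S2 -> S = S1 `|` S2 -> S1 `&` S2 = set0 ->
    S1 A -> S1 B.

Lemma zconnected_linked (S : set 'M[K]_N) A0 :
  S A0 -> (forall A, S A -> zlinked S A A0) -> zconnected S.
Proof.
move=> SA0 hS; split; first by exists A0.
move=> S1 S2 c1 c2 eS dS.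
have [S1A|nS1A] := pselect (S1 A0).
  right; rewrite -subset0 => A S2A.
  have : S2 A0 by apply: (hS A _ S2 S1) => //; [rewrite eS; right|rewrite setUC|rewrite setIC].
  by move=> S2A0; have : (S1 `&` S2) A0 by []; rewrite dS.
by left; rewrite -subset0 => A S1A; apply: nS1A; apply: (hS A _ S1 S2) => //; rewrite eS; left.
Qed.

(** If S1 and S2 separated two points of the curve, the product of an equation of S1 and
    an equation of S2 would vanish along the curve, although neither factor does; but
    a polynomial in s with infinitely many zeros is zero. *)
Lemma zlinked_ratcurve (S : set 'M[K]_N) d (gam : K -> 'M[K]_N) a b :
  (forall i j, ratfun d (fun s => gam s i j)) -> 
  (forall s, d.[s] != 0 -> S (gam s)) -> d.[a] != 0 -> d.[b] != 0 ->
  zlinked S (gam a) (gam b).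
Proof.
move=> hg hS da db S1 S2 c1 c2 eS dS S1a; apply: contrapT => nS1b.
have S12 s : d.[s] != 0 -> S1 (gam s) \/ S2 (gam s) by move=> /hS; rewrite eS.
have nS2a : ~ S2 (gam a) by move=> S2a; have : (S1 `&` S2) (gam a) by []; rewrite dS.
have ug s : d.[s] != 0 -> gam s \in unitmx.
  by move=> /S12[]; apply: zclosed_unit.
have [f pf [f0 fb]] := zclosed_sep c1 (ug _ db) nS1b.
have [g pg [g0 ga]] := zclosed_sep c2 (ug _ da) nS2a.
have [k [p hp]] := polyfun_ratcurve hg pf.
have [l [q hq]] := polyfun_ratcurve hg pg.
have : p * q * d = 0.
  apply: poly_fun_eq0 => s; rewrite !hornerM.
  have [->|ds] := eqVneq d.[s] 0; first by rewrite mulr0.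
  rewrite -hp // -hq //=; case: (S12 _ ds) => [/f0|/g0] ->; by rewrite !mulr0 ?mul0r.
have dn0 : d != 0 by apply: contraNneq da => ->; rewrite horner0.
move/eqP; rewrite !mulf_eq0 (negbTE dn0) orbF => /orP[]/eqP z.
  have := hp b db; rewrite z horner0 /= => /eqP.
  by rewrite mulf_eq0 expf_eq0 (negbTE db) andbF (negbTE fb).
have := hq a da; rewrite z horner0 /= => /eqP.
by rewrite mulf_eq0 expf_eq0 (negbTE da) andbF (negbTE ga).
Qed.

Lemma zlinked_curve (S : set 'M[K]_N) (gam : K -> 'M[K]_N) (q : 'I_N -> 'I_N -> {poly K}) a b :
  (forall s i j, gam s i j = (q i j).[s]) -> (forall s, S (gam s)) ->
  zlinked S (gam a) (gam b).
Proof.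
move=> hq hS; apply: (@zlinked_ratcurve _ 1) => //; rewrite ?hornerC ?oner_eq0 //.
by move=> i j; exists 0%N, (q i j) => s _; rewrite expr0 mul1r hq.
Qed.

Lemma zlinked_trans (S : set 'M[K]_N) A B C :
  zlinked S A B -> zlinked S B C -> zlinked S A C.
Proof. by move=> h1 h2 S1 S2 c1 c2 eS dS /(h1 _ _ c1 c2 eS dS) /(h2 _ _ c1 c2 eS dS). Qed.

End Curves.

(** * Tangent spaces at the identity *)

Section Tangent.
Context (K : numFieldType) (N : nat).

Lemma quadratic_remainder (a a' b b' : K) (q q' : {poly K}) :
  (forall s, a + s * b + s ^+ 2 * q.[s] = a' + s * b' + s ^+ 2 * q'.[s]) -> b = b'.
Proof.
move=> h.
have e : a%:P + 'X * b%:P + 'X^2 * q = a'%:P + 'X * b'%:P + 'X^2 * q'.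
  by apply: poly_fun_eq => s; rewrite !hornerE.
have := congr1 (fun p : {poly K} => p`_1) e.
by rewrite !coefD !coefC !coefXM !coefC !coefXnM !addr0 !add0r.
Qed.

(** Each equation f of S gives a linear equation of mx_Lie S, its coefficient of s. *)
Lemma mx_Lie_polyfun (S : set 'M[K]_N) (X : 'M[K]_N) f b (q : {poly K}) :
  mx_Lie S X -> polyfun f -> (forall A, S A -> f A = 0) ->
  (forall s, f (1%:M + s *: X) = f 1%:M + s * b + s ^+ 2 * q.[s]) -> b = 0.
Proof.
move=> LX /polyfunP [p hp] f0 hb.
have [r hr] := mxpoly_taylor1 (@idfun K) p 1%:M X.
rewrite -(LX p) => [|A SA]; last by rewrite hp f0.
apply: (@quadratic_remainder (f 1%:M) (f 1%:M) b _ q r) => s.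
by rewrite -hb -hp hr hp.
Qed.

(** The vectors to which this applies are those with X^2 = 0, as 1 + s X is then the
    exponential of s X. *)
Lemma mx_Lie_line (S : set 'M[K]_N) (X : 'M[K]_N) :
  (forall s, S (1%:M + s *: X)) -> mx_Lie S X.
Proof.
move=> hS p hp; have [r hr] := mxpoly_taylor1 (@idfun K) p 1%:M X.
apply: (@quadratic_remainder (mxpoly_eval idfun p 1%:M) 0 _ _ r 0) => s.
by rewrite -hr hp // horner0 !mulr0 !addr0.
Qed.

Lemma mx_Lie_sub (S S' : set 'M[K]_N) : S `<=` S' -> mx_Lie S `<=` mx_Lie S'.
Proof. by move=> sS X LX p hp; apply: LX => A /sS /hp. Qed.

End Tangent.

(** * Connected solvable groups have common eigenvectors *)

Section Derived.
Context (K : fieldType) (N : nat).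
Implicit Types (S G H : set 'M[K]_N).

Lemma mx_subgroup_unit S A : mx_subgroup S -> S A -> A \in unitmx.
Proof. by case=> sU _ _ _ /sU. Qed.

Lemma derived_commutator S A B : S A -> S B -> mx_derived S (A *m B *m invmx A *m invmx B).
Proof. by move=> SA SB H _; apply. Qed.

Lemma derived_least S H : mx_subgroup H ->
  (forall A B, S A -> S B -> H (A *m B *m invmx A *m invmx B)) -> mx_derived S `<=` H.
Proof. by move=> gH hH A; apply. Qed.

Lemma derived_sub S : mx_subgroup S -> mx_derived S `<=` S.
Proof.
move=> gS; apply: derived_least => // A B SA SB; case: gS => _ _ hM hV.
exact: (hM _ _ (hM _ _ (hM _ _ SA SB) (hV _ SA)) (hV _ SB)).
Qed.

Lemma derived_mono S S' : S `<=` S' -> mx_derived S `<=` mx_derived S'.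
Proof. by move=> sS A dA H gH hH; apply: dA => // B C /sS SB /sS SC; apply: hH. Qed.

Lemma derived_subgroup S : mx_subgroup S -> mx_subgroup (mx_derived S).
Proof.
move=> gS; split=> [A /(derived_sub gS)/(mx_subgroup_unit gS)//| | |].
- by move=> H [].
- by move=> A B dA dB H gH hH; case: (gH) => _ _ hM _; apply: hM; [apply: dA|apply: dB].
- by move=> A dA H gH hH; case: (gH) => _ _ _ hV; apply: hV; apply: dA.
Qed.

Lemma derived_conj S A B : mx_subgroup S -> S A -> mx_derived S B ->
  mx_derived S (A *m B *m invmx A).
Proof.
move=> gS SA dB; have SB := derived_sub gS dB.
have uB := mx_subgroup_unit gS SB.
case: (derived_subgroup gS) => _ _ hM _.
by rewrite -(mulmxKV uB (A *m B *m invmx A)); apply: hM => //; apply: derived_commutator.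
Qed.

End Derived.

Lemma invmx_det1 (K : comUnitRingType) N (A : 'M[K]_N) : \det A = 1 -> invmx A = \adj A.
Proof. by move=> dA; rewrite /invmx unitmxE dA unitr1 invr1 scale1r. Qed.

(** For f with finitely many values on the derived group D, the function
    b |-> f ([b, c] h) is constant on S for all c in S and h in D, hence equal to
    f h; so f is invariant under the translations by D. *)
Lemma derived_values (K : fieldType) N (S : set 'M[K]_N) :
  mx_subgroup S -> (forall A, S A -> \det A = 1) ->
  finite_values_constant S -> finite_values_constant (mx_derived S).
Proof.
move=> gS S1 fcS f c pf hc; pose D := mx_derived S.
have gD := derived_subgroup gS; case: (gD) => uD D1 DM DV.
have [_ S_1 SM SV] := gS.
suff inv A : D A -> forall C, D C -> f (A *m C) = f C.
  have fD1 A : D A -> f A = f 1%:M by move=> DA; have := inv A DA _ D1; rewrite mulmx1.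
  by move=> A B /fD1 -> /fD1 ->.
pose H := [set A | D A /\ forall C, D C -> f (A *m C) = f C].
suff sH : D `<=` H by move=> /sH [].
apply: derived_least; last first.
  move=> B0 C0 SB SC; split; first exact: derived_commutator.
  move=> C DC.
  pose g X := f (X *m (C0 *m \adj X *m invmx C0 *m C)).
  have pg : polyfun g.
    apply: (polyfun_comp pf); apply: polymap_mul; first exact: polymap_id.
    apply: polymap_mul; last exact: polymap_const.
    apply: polymap_mul; last exact: polymap_const.
    apply: polymap_mul; first exact: polymap_const.
    by apply: polymap_adj; apply: polymap_id.
  have gE X : S X -> g X = f (X *m C0 *m invmx X *m invmx C0 *m C).
    by move=> SX; rewrite /g (invmx_det1 (S1 X SX)) !mulmxA.
  rewrite -gE // (fcS _ c pg _ B0 1%:M) //.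
    by rewrite gE // mul1mx invmx1 mulmx1 mulmxV ?mul1mx // (mx_subgroup_unit gS).
  move=> X SX; rewrite gE //; apply: hc; apply: DM => //; exact: derived_commutator.
split=> [B [/uD] //| | |].
- by split=> // C _; rewrite mul1mx.
- move=> B C [DB hB] [DC hC]; split; first exact: DM.
  by move=> E DE; rewrite -mulmxA hB ?hC //; apply: DM.
- move=> B [DB hB]; split; first exact: DV.
  move=> C DC; rewrite -[X in _ = f X](mulKVmx (uD _ DB)) hB //.
  by apply: DM => //; apply: DV.
Qed.

(** A subspace given by a predicate is the row space of a matrix: of maximal rank
    among those whose row space satisfies the predicate. *)
Lemma subspace_mx (K : fieldType) d (P : 'rV[K]_d -> Prop) :
  P 0 -> (forall a u v, P u -> P v -> P (a *: u + v)) ->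
  exists W : 'M[K]_d, forall u, P u <-> (u <= W)%MS.
Proof.
move=> P0 PD.
pose Q r := `[< exists W : 'M[K]_d, \rank W = r /\ forall u, (u <= W)%MS -> P u >].
have Q0 : exists r, Q r.
  exists 0%N; apply/asboolP; exists 0; rewrite mxrank0; split=> // u.
  by rewrite submx0 => /eqP ->.
have Qd r : Q r -> (r <= d)%N by move/asboolP => [W [<- _]]; apply: rank_leq_row.
case: (ex_maxnP Q0 Qd) => r /asboolP [W [rW hW]] maxr.
exists W => u; split=> [Pu|/hW //].
have /maxr : Q (\rank (W + u)%MS).
  apply/asboolP; exists (W + u)%MS; split=> // w /sub_addsmxP [[a b] /= ->].
  rewrite addrC (mx11_scalar b) mul_scalar_mx; apply: PD => //.
  by apply: hW; rewrite submxMl.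
rewrite -rW => le_r; apply: (submx_trans (addsmxSr W u)).
by have := (mxrank_leqif_sup (addsmxSl W u)).2; rewrite eqn_leq le_r mxrankS ?addsmxSl // => <-.
Qed.

Section LieKolchin.
Context (K : numClosedFieldType).

Definition is_polyrep N d (G : set 'M[K]_N) (rho : 'M[K]_N -> 'M[K]_d) : Prop :=
  [/\ polymap rho, rho 1%:M = 1%:M &
      forall A B, G A -> G B -> rho (A *m B) = rho A *m rho B].

Definition common_eigenvector N d (G : set 'M[K]_N) (rho : 'M[K]_N -> 'M[K]_d)
    (v : 'rV[K]_d) : Prop :=
  v != 0 /\ forall A, G A -> exists c, v *m rho A = c *: v.

Lemma closed_roots (p : {poly K}) : p != 0 -> exists r : seq K, forall x, root p x -> x \in r.
Proof.
move=> p0; have [r er] := closed_field_poly_normal p.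
by exists r => x; rewrite er rootZ ?lead_coef_eq0 // root_prod_XsubC.
Qed.

Lemma closed_eigenvalue d (A : 'M[K]_d) : (0 < d)%N -> exists a, eigenvalue A a.
Proof.
move=> d0; have [|a ra] := closed_rootP (char_poly A) _.
  by rewrite size_char_poly; lia.
by exists a; rewrite eigenvalue_root_char.
Qed.

(** The action on a stable subspace, in the coordinates of a basis of it. *)
Lemma common_eigenvector_sub N d (G : set 'M[K]_N) (rho : 'M[K]_N -> 'M[K]_d) (W : 'M[K]_d) :
  (forall A, G A -> (W *m rho A <= W)%MS) -> is_polyrep G rho ->
  let rho' := fun A => row_base W *m rho A *m pinvmx (row_base W) in
  is_polyrep G rho' /\ forall v, common_eigenvector G rho' v ->
  common_eigenvector G rho (v *m row_base W).
Proof.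
move=> sW [prho rho1 rhoM] rho'.
have fb := row_base_free W.
have stb A : G A -> rho' A *m row_base W = row_base W *m rho A.
  move=> GA; rewrite /rho' mulmxKpV // !eq_row_base.
  by rewrite (eqmxMr _ (eq_row_base W)) sW.
split.
  split.
  - apply: polymap_mul; last exact: polymap_const.
    by apply: polymap_mul => //; exact: polymap_const.
  - by rewrite /rho' rho1 mulmx1 mulmxVp.
  - move=> A B GA GB; rewrite {1}/rho' rhoM // !mulmxA -stb //.
    by rewrite /rho' !mulmxA.
move=> v [v0 hv]; split.
  apply: contraNneq v0 => /(congr1 (mulmx^~ (pinvmx (row_base W)))).
  by rewrite mul0mx -mulmxA mulmxVp // mulmx1 => ->.
move=> A GA; have [c hc] := hv A GA; exists c.
by rewrite -mulmxA -stb // mulmxA hc scalemxAl.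
Qed.

(** The Lie-Kolchin theorem. In an irreducible representation, the derived group G'
    has a common eigenvector v by induction; the conjugates of h in G' act on v
    through eigenvalues of h, finitely many, so connectedness makes the G'-weight
    space of v stable under G, hence everything.  So G' acts by scalars of
    determinant 1, again finitely many, hence trivially; then G acts through
    commuting matrices, whose eigenspaces are stable. *)
Theorem lie_kolchin m N (G : set 'M[K]_N) d (rho : 'M[K]_N -> 'M[K]_d) :
  mx_subgroup G -> (forall A, G A -> \det A = 1) -> finite_values_constant G ->
  iter m (@mx_derived K N) G `<=` [set 1%:M] -> (0 < d)%N -> is_polyrep G rho ->
  exists v, common_eigenvector G rho v.
Proof.
elim: m => [|m IHm] in G d rho *; move=> gG G1 fcG solG d0 rG.
  have [prho rho1 _] := rG.
  exists (delta_mx 0 (Ordinal d0)); split.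
    apply/eqP => /rowP/(_ (Ordinal d0)); rewrite !mxE !eqxx /= => /eqP.
    by rewrite oner_eq0.
  by move=> A /solG /= ->; exists 1; rewrite rho1 mulmx1 scale1r.
elim/ltn_ind: d => d IHd in rho d0 rG *.
have [[W [W0 rW sW]]|irr] := pselect (exists W : 'M[K]_d,
    [/\ W != 0, (\rank W < d)%N & forall A, G A -> (W *m rho A <= W)%MS]).
  have [rG' hv] := common_eigenvector_sub sW rG.
  have [|v /hv hv'] := IHd _ rW _ _ rG'; first by rewrite lt0n mxrank_eq0.
  by eexists; exact: hv'.
have {}irr (W : 'M[K]_d) : W != 0 -> (forall A, G A -> (W *m rho A <= W)%MS) -> 
    forall u : 'rV_d, (u <= W)%MS.
  move=> W0 sW u; apply: submx_full; rewrite /row_full eqn_leq rank_leq_col leqNgt.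
  by apply/negP => rW; apply: irr; exists W.
have [prho rho1 rhoM] := rG.
have [uG G_1 GM GV] := gG.
pose D := mx_derived G.
have gD : mx_subgroup D := derived_subgroup gG.
have sDG : D `<=` G := derived_sub gG.
have fcD : finite_values_constant D := derived_values gG G1 fcG.
have rhoV A : G A -> rho A *m rho (invmx A) = 1%:M.
  move=> GA; have GA' := GV _ GA.
  by rewrite -rhoM // mulmxV ?rho1 //; apply: uG.
have rhoV' A : G A -> rho (invmx A) *m rho A = 1%:M.
  move=> GA; have GA' := GV _ GA.
  by rewrite -rhoM // mulVmx ?rho1 //; apply: uG.
have rhoJ A B : G A -> G B -> rho (A *m B *m invmx A) = rho A *m rho B *m rho (invmx A).
  by move=> GA GB; rewrite (rhoM _ _ (GM _ _ GA GB) (GV _ GA)) rhoM.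
have rhoR A B : G A -> G B ->
    rho (A *m B *m invmx A *m invmx B) = rho A *m rho B *m rho (invmx A) *m rho (invmx B).
  move=> GA GB; rewrite -rhoJ // rhoM //; last exact: GV.
  exact: (GM _ _ (GM _ _ GA GB) (GV _ GA)).
have [||v [v0 hv]] := IHm D d rho gD (fun A DA => G1 A (sDG A DA)) fcD _ d0.
- by rewrite iterSr in solG.
- by split=> // A B /sDG GA /sDG GB; apply: rhoM.
have [k vk] : exists k, v 0 k != 0.
  apply: contrapT => nk; move/eqP: v0; apply; apply/rowP => k; rewrite mxE.
  by apply/eqP/negPn/negP => vk; apply: nk; exists k.
pose chi h := (v *m rho h) 0 k / v 0 k.
have chiE h : D h -> v *m rho h = chi h *: v.
  by move=> /hv [c hc]; rewrite /chi hc mxE mulfK.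
have pchi : polyfun chi.
  apply: polyfunM; last exact: polyfun_const.
  by apply: polymap_mul => //; exact: polymap_const.
have chi_conj h g : D h -> G g -> chi (g *m h *m invmx g) = chi h.
  move=> Dh Gg; have Gh := sDG _ Dh.
  pose f X := chi (X *m h *m \adj X).
  have pf : polyfun f.
    apply: (polyfun_comp pchi); apply: polymap_mul; last by apply: polymap_adj; apply: polymap_id.
    by apply: polymap_mul; [exact: polymap_id|exact: polymap_const].
  have fE X : G X -> f X = chi (X *m h *m invmx X) by move=> GX; rewrite /f (invmx_det1 (G1 X GX)).
  have [r hr] := closed_roots (monic_neq0 (char_poly_monic (rho h))).
  rewrite -fE // (fcG f r pf _ g 1%:M) //; first by rewrite fE // mul1mx invmx1 mulmx1.
  move=> X GX; apply: hr; rewrite -eigenvalue_root_char fE //.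
  apply/eigenvalueP; exists (v *m rho X).
    have := chiE _ (derived_conj gG GX Dh).
    rewrite rhoJ // => e.
    by rewrite scalemxAl -e !mulmxA -(mulmxA _ (rho _) (rho X)) rhoV' // mulmx1.
  apply: contraNneq v0 => /(congr1 (mulmx^~ (rho (invmx X)))).
  by rewrite mul0mx -mulmxA rhoV // mulmx1 => ->.
have [||W hW] := @subspace_mx K d (fun u => forall h, D h -> u *m rho h = chi h *: u).
- by move=> h _; rewrite mul0mx scaler0.
- move=> a u w hu hw h Dh; rewrite mulmxDl -scalemxAl hu // hw //.
  by rewrite scalerDr !scalerA mulrC.
have rhoD h : D h -> rho h = (chi h)%:M.
  move=> Dh; apply/row_matrixP => i.
  rewrite -[in LHS](mul1mx (rho h)) row_mul.
  have /hW -> // : (row i 1%:M <= W)%MS.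
    apply: irr.
      apply: contraNneq v0 => W0; have /hW : forall h, D h -> v *m rho h = chi h *: v by [].
      by rewrite W0 submx0.
    move=> g Gg; apply/row_subP => j; rewrite row_mul; apply/hW => h' Dh'.
    have /hW wj : (row j W <= W)%MS by apply: row_sub.
    have := wj _ (derived_conj gG Gg Dh'); rewrite rhoJ ?chi_conj //; last exact: sDG.
    move=> /(congr1 (mulmx^~ (rho g))).
    by rewrite -!mulmxA rhoV' // mulmx1 scalemxAl.
  by apply/rowP => j; rewrite !mxE; case: eqP => _; rewrite ?mulr1n ?mulr0n ?mulr1 ?mulr0.
have det1 h : D h -> \det (rho h) = 1.
  have sH : D `<=` [set A | G A /\ \det (rho A) = 1].
    apply: derived_least.
      split=> [A [/uG]//| | |].
      - by split=> //; rewrite rho1 det1.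
      - by move=> A B [GA dA] [GB dB]; split; [exact: GM|rewrite rhoM // det_mulmx dA dB mulr1].
      - move=> A [GA dA]; split; first exact: GV.
        by have := congr1 determinant (rhoV A GA); rewrite det_mulmx det1 dA mul1r.
    move=> A B GA GB; split.
      exact: (GM _ _ (GM _ _ (GM _ _ GA GB) (GV _ GA)) (GV _ GB)).
    rewrite rhoR // !det_mulmx.
    have := congr1 determinant (rhoV A GA); rewrite det_mulmx det1 => eA.
    have := congr1 determinant (rhoV B GB); rewrite det_mulmx det1 => eB.
    by rewrite (mulrAC (\det (rho A))) eA mul1r eB.
  by move=> /sH [].
have rhoD1 h : D h -> rho h = 1%:M.
  move=> Dh; rewrite rhoD //; congr (_%:M).
  have [r hr] := @closed_roots ('X^d - 1) (monic_neq0 (monicXnsubC 1 d0)).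
  have D1 : D 1%:M by case: gD.
  rewrite (fcD chi r pchi _ h 1%:M) //.
    by rewrite /chi rho1 mulmx1 divff.
  move=> A DA; apply: hr; rewrite rootE !hornerE ?hornerXn; rewrite subr_eq0.
  by rewrite -(det1 A DA) rhoD // det_scalar.
have rhoC A B : G A -> G B -> rho A *m rho B = rho B *m rho A.
  move=> GA GB; have := rhoD1 _ (derived_commutator GA GB).
  rewrite rhoR // => /(congr1 (mulmx^~ (rho B))).
  rewrite mul1mx -!mulmxA rhoV' // mulmx1 !mulmxA => /(congr1 (mulmx^~ (rho A))).
  by rewrite -!mulmxA rhoV' // mulmx1.
have rhoS A : G A -> exists a, forall u : 'rV_d, u *m rho A = a *: u.
  move=> GA; have [a ea] := closed_eigenvalue (rho A) d0.
  exists a => u; apply/eigenspaceP; apply: (irr (eigenspace (rho A) a)) => // B GB.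
  apply/eigenspaceP; rewrite -mulmxA -rhoC // mulmxA.
  have /eigenspaceP e := submx_refl (eigenspace (rho A) a).
  by rewrite e -scalemxAl.
exists v; split=> // A /rhoS [a ha]; by exists a.
Qed.

End LieKolchin.

(** * Hyperbolic bases of eigenvectors *)

Definition hyperbolic_mx (K : nzRingType) N : 'M[K]_N := \matrix_(i, j) (j == rev_ord i)%:R.

Lemma rev_ord_neq n N (evenN : N = (n + n)%N) (i : 'I_N) : rev_ord i != i.
Proof. by apply/eqP => /(congr1 val) /=; have := ltn_ord i; lia. Qed.

Section Hyperbolic.
Context (K : numClosedFieldType) (N : nat) (F : 'M[K]_N) (T : set 'M[K]_N).
Hypothesis symF : F^T = F.
Hypothesis unitF : F \in unitmx.
Hypothesis presF : forall A, T A -> A *m F *m A^T = F.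
Implicit Types (u v w x : 'rV[K]_N).

Definition bform u v : K := (u *m F *m v^T) 0 0.

Lemma bformC u v : bform u v = bform v u.
Proof.
rewrite /bform; have -> : v *m F *m u^T = (u *m F *m v^T)^T.
  by rewrite !trmx_mul trmxK symF mulmxA.
by rewrite [RHS]mxE.
Qed.

Lemma bformDl u v w : bform (u + v) w = bform u w + bform v w.
Proof. by rewrite /bform !mulmxDl mxE. Qed.

Lemma bformZl a u v : bform (a *: u) v = a * bform u v.
Proof. by rewrite /bform -!scalemxAl mxE. Qed.

Lemma bformDr u v w : bform u (v + w) = bform u v + bform u w.
Proof. by rewrite bformC bformDl !(bformC u). Qed.

Lemma bformZr a u v : bform u (a *: v) = a * bform u v.
Proof. by rewrite bformC bformZl (bformC u). Qed.

Lemma bformNl u v : bform (- u) v = - bform u v.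
Proof. by rewrite -scaleN1r bformZl mulN1r. Qed.

Lemma bform_suml (J : Type) (r : seq J) (P : pred J) (G : J -> 'rV[K]_N) v :
  bform (\sum_(j <- r | P j) G j) v = \sum_(j <- r | P j) bform (G j) v.
Proof. by rewrite /bform !mulmx_suml summxE. Qed.

Lemma bform_row (Q : 'M[K]_N) i j : (Q *m F *m Q^T) i j = bform (row i Q) (row j Q).
Proof.
rewrite /bform tr_row -row_mul [RHS]mxE; rewrite [LHS]mxE.
by apply: eq_bigr => k _; rewrite !mxE.
Qed.

Lemma bform_act A u v : T A -> bform (u *m A) (v *m A) = bform u v.
Proof. by move=> TA; rewrite /bform trmx_mul -[in RHS](presF TA) !mulmxA. Qed.

Definition weight_vector v (lam : 'M[K]_N -> K) : Prop :=
  forall A, T A -> v *m A = lam A *: v.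

(** An isometry A multiplies bform u v by lam A * mu A, and also leaves it unchanged. *)
Lemma weight_pair u v lam mu A :
  weight_vector u lam -> weight_vector v mu -> bform u v != 0 -> T A -> lam A * mu A = 1.
Proof.
move=> hu hv nz TA; apply: (mulIf nz).
by rewrite mul1r -[RHS](bform_act u v TA) hu // hv // bformZl bformZr mulrA.
Qed.

Variable Q0 : 'M[K]_N.
Hypothesis unitQ0 : Q0 \in unitmx.
Variable wt : 'I_N -> 'M[K]_N -> K.
Hypothesis wtP : forall i, weight_vector (row i Q0) (wt i).
Hypothesis wt_sq : forall i, (forall A, T A -> wt i A ^+ 2 = 1) -> forall A, T A -> wt i A = 1.

Lemma bform_nondeg v : v != 0 -> exists i, bform v (row i Q0) != 0.
Proof.
move=> v0; apply: contrapT => h; move/eqP: v0; apply.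
have : v *m F *m Q0^T = 0.
  apply/rowP => i; rewrite [RHS]mxE; apply/eqP/negPn/negP => nz; apply: h; exists i.
  apply: contraNneq nz => e; apply/eqP; rewrite -[RHS]e /bform tr_row [LHS]mxE [RHS]mxE.
  by apply: eq_bigr => k _; rewrite !mxE.
move/(congr1 (mulmx^~ (invmx Q0^T))); rewrite mul0mx mulmxK ?unitmx_tr //.
by move/(congr1 (mulmx^~ (invmx F))); rewrite mul0mx mulmxK.
Qed.

Definition hyperbolic_family m (v w : nat -> 'rV[K]_N) : Prop :=
  (forall k, (k < m)%N -> (exists lam, weight_vector (v k) lam) /\
                          (exists mu, weight_vector (w k) mu)) /\
  (forall k l, (k < m)%N -> (l < m)%N ->
     [/\ bform (v k) (v l) = 0, bform (w k) (w l) = 0 & bform (v k) (w l) = (k == l)%:R]).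

(** The orthogonal projection onto the orthogonal complement of a hyperbolic family. *)
Definition hproj m (v w : nat -> 'rV[K]_N) x : 'rV[K]_N :=
  x - \sum_(k < m) (bform x (w k) *: v k + bform x (v k) *: w k).

Section Step.
Variables (m : nat) (v w : nat -> 'rV[K]_N).
Hypothesis hvw : hyperbolic_family m v w.
Local Notation proj := (hproj m v w).

Lemma hproj_orthv x l : (l < m)%N -> bform (proj x) (v l) = 0.
Proof.
move=> lm; have [_ h] := hvw.
rewrite bformDl bformNl bform_suml (bigD1 (Ordinal lm)) //= big1.
  rewrite bformDl !bformZl; have [-> _ _] := h l l lm lm.
  have [_ _] := h l l lm lm; rewrite (bformC (w l)) eqxx => ->.
  by rewrite mulr0 mulr1 addr0 add0r subrr.
move=> k nk; rewrite bformDl !bformZl; have [-> _ _] := h k l (ltn_ord k) lm.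
have [_ _] := h l k lm (ltn_ord k); rewrite (bformC (w k)) => ->.
by rewrite eq_sym (_ : (k == l :> nat) = false) ?mulr0 ?addr0 //; apply: negbTE.
Qed.

Lemma hproj_orthw x l : (l < m)%N -> bform (proj x) (w l) = 0.
Proof.
move=> lm; have [_ h] := hvw.
rewrite bformDl bformNl bform_suml (bigD1 (Ordinal lm)) //= big1.
  rewrite bformDl !bformZl; have [_ -> ->] := h l l lm lm.
  by rewrite eqxx mulr0 mulr1 !addr0 subrr.
move=> k nk; rewrite bformDl !bformZl; have [_ -> ->] := h k l (ltn_ord k) lm.
by rewrite (_ : (k == l :> nat) = false) ?mulr0 ?addr0 //; apply: negbTE.
Qed.

Lemma hproj_bform u x : (forall l, (l < m)%N -> bform u (v l) = 0 /\ bform u (w l) = 0) ->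
  bform u (proj x) = bform u x.
Proof.
move=> hu; rewrite bformC bformDl bformNl bform_suml big1 ?oppr0 ?addr0 1?bformC //.
move=> k _; have [uv uw] := hu k (ltn_ord k).
by rewrite bformDl !bformZl (bformC (v k)) (bformC (w k)) uv uw !mulr0 addr0.
Qed.

(** A coefficient of the projection is nonzero only if the corresponding vector of the
    family has the same weight as x, by weight_pair. *)
Lemma hproj_weight x lam : weight_vector x lam -> weight_vector (proj x) lam.
Proof.
move=> hx A TA; have [hw _] := hvw.
rewrite mulmxBl hx // scalerBr mulmx_suml scaler_sumr; congr (_ - _).
apply: eq_bigr => k _; have [[l1 h1] [l2 h2]] := hw k (ltn_ord k).
have [_ _ vw1] := hvw.2 k k (ltn_ord k) (ltn_ord k); rewrite eqxx in vw1.
have l12 : l1 A * l2 A = 1.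
  by apply: (weight_pair h1 h2) => //; rewrite vw1 oner_eq0.
rewrite mulmxDl -!scalemxAl h1 // h2 // scalerDr !scalerA; congr (_ *: _ + _ *: _).
  have [->|nz] := eqVneq (bform x (w k)) 0; first by rewrite mulr0 mul0r.
  rewrite mulrC; congr (_ * _); have xl := weight_pair hx h2 nz TA.
  have l20 : l2 A != 0.
    by apply/eqP => z; move: xl; rewrite z mulr0 => /esym/eqP; rewrite oner_eq0.
  by apply: (mulIf l20); rewrite xl l12.
have [->|nz] := eqVneq (bform x (v k)) 0; first by rewrite mulr0 mul0r.
rewrite mulrC; congr (_ * _); have xl := weight_pair hx h1 nz TA.
have l10 : l1 A != 0.
  by apply/eqP => z; move: xl; rewrite z mulr0 => /esym/eqP; rewrite oner_eq0.
by apply: (mulIf l10); rewrite xl mulrC l12.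
Qed.

(** If the projections of the basis Q0 lie on one line, then Q0 is contained in the span of
    the 2 m vectors of the family and of this line. *)
Lemma hproj_span (u : 'rV[K]_N) :
  (forall i, exists c, proj (row i Q0) = c *: u) -> (N <= m + m + 1)%N.
Proof.
move=> h; pose V := \matrix_(k < m) v k; pose W := \matrix_(k < m) w k.
suff : (Q0 <= col_mx (col_mx V W) u)%MS.
  move/mxrankS; rewrite mxrank_unit // => /leq_trans; apply.
  exact: rank_leq_row.
apply/row_subP => i; have [c hc] := h i.
have -> : row i Q0 = c *: u + \sum_(k < m)
    (bform (row i Q0) (w k) *: v k + bform (row i Q0) (v k) *: w k).
  by rewrite -hc subrK.
have := submx_refl (col_mx (col_mx V W) u).
rewrite !col_mx_sub => /andP[/andP[sV sW] su].
apply: addmx_sub; first exact: scalemx_sub.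
apply: summx_sub => k _; apply: addmx_sub; apply: scalemx_sub.
  by apply: submx_trans sV; rewrite -(rowK v) row_sub.
by apply: submx_trans sW; rewrite -(rowK w) row_sub.
Qed.

(** Among the projections of the weight vectors of Q0, either a nonzero one is
    isotropic, or two independent ones are anisotropic, hence of trivial weight, and
    have an isotropic combination. *)
Lemma isotropic_weight_vector : (m + m + 1 < N)%N ->
  exists u lam, [/\ u != 0, weight_vector u lam, bform u u = 0 &
    forall l, (l < m)%N -> bform u (v l) = 0 /\ bform u (w l) = 0].
Proof.
move=> mN; pose z i := proj (row i Q0).
have zP i : weight_vector (z i) (wt i) by apply: hproj_weight.
have zO i l : (l < m)%N -> bform (z i) (v l) = 0 /\ bform (z i) (w l) = 0.
  by move=> lm; rewrite hproj_orthv ?hproj_orthw.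
have [[i [zi0 ziso]]|nz] := pselect (exists i, z i != 0 /\ bform (z i) (z i) = 0).
  by exists (z i), (wt i); split=> // l; apply: zO.
have ani i : z i != 0 -> bform (z i) (z i) != 0.
  by move=> zi0; apply/negP => /eqP e; apply: nz; exists i.
have tw i : z i != 0 -> forall A, T A -> wt i A = 1.
  move=> /ani zi; apply: wt_sq => A TA; rewrite expr2.
  exact: (weight_pair (zP i) (zP i)).
have [i zi0] : exists i, z i != 0.
  apply: contrapT => h; suff : (N <= m + m + 1)%N by rewrite leqNgt mN.
  apply: (hproj_span (u := 0)) => i; exists 0; rewrite scale0r.
  by apply/eqP/negPn/negP => zi; apply: h; exists i.
have [j zij] : exists j, ~ exists c, z j = c *: z i.
  apply: contrapT => h; suff : (N <= m + m + 1)%N by rewrite leqNgt mN.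
  apply: (hproj_span (u := z i)) => j; apply: contrapT => h'; by apply: h; exists j.
have zj0 : z j != 0.
  by apply/negP => /eqP e; apply: zij; exists 0; rewrite scale0r.
have d0 := ani i zi0.
(* The isotropic combination z j + c z i is given by a root c of d c^2 + 2 b c + a. *)
pose a := bform (z j) (z j); pose b := bform (z j) (z i); pose d := bform (z i) (z i).
pose c := (sqrtC (b ^+ 2 - a * d) - b) / d.
exists (z j + c *: z i), (fun=> 1); split.
- apply/negP => /eqP e; apply: zij; exists (- c); apply/eqP.
  by rewrite -subr_eq0 scaleNr opprK e.
- move=> A TA; rewrite mulmxDl -scalemxAl !zP // !tw // !scale1r //.
- rewrite bformDl (bformDr (z j)) (bformDr (c *: z i)) !bformZl !bformZr.
  rewrite (bformC (z i) (z j)) -/a -/b -/d.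
  have sq : sqrtC (b ^+ 2 - a * d) ^+ 2 = b ^+ 2 - a * d by rewrite sqrtCK.
  have cd : c * d = sqrtC (b ^+ 2 - a * d) - b by rewrite /c mulfVK.
  apply: (mulIf d0); rewrite mul0r -/d.
  have -> : (a + c * b + (c * b + c * (c * d))) * d = (c * d + b) ^+ 2 - (b ^+ 2 - a * d).
    by ring.
  by rewrite cd subrK sq subrr.
- move=> l lm; rewrite 2!(bformDl (z j)) !bformZl; have [-> ->] := zO i l lm.
  by have [-> ->] := zO j l lm; rewrite !mulr0 !addr0.
Qed.

(** An isotropic weight vector u is paired with the projection of some vector of Q0, made
    isotropic by subtracting a multiple of u. This multiple is nonzero only if the
    weight of w0 is its own inverse, hence equal to that of u. *)
Lemma hyperbolic_step : (m + m + 1 < N)%N ->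
  exists v' w' : nat -> 'rV[K]_N, hyperbolic_family m.+1 v' w'.
Proof.
move=> mN; have [u [lam [u0 hu iso hO]]] := isotropic_weight_vector mN.
have [i nz] := bform_nondeg u0.
pose z := proj (row i Q0); have hz : weight_vector z (wt i) by apply: hproj_weight.
have uz : bform u z != 0 by rewrite hproj_bform.
pose w0 := (bform u z)^-1 *: z; pose a := bform w0 w0 / 2.
pose w1 := w0 - a *: u.
have uw0 : bform u w0 = 1 by rewrite bformZr mulVf.
have hw0 : weight_vector w0 (wt i).
  by move=> A TA; rewrite -scalemxAl hz // !scalerA mulrC.
have w1E x : bform w1 x = bform w0 x - a * bform u x.
  by rewrite (bformDl w0) bformNl bformZl.
have uw1 : bform u w1 = 1.
  by rewrite bformC w1E iso mulr0 subr0 bformC.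
have w11 : bform w1 w1 = 0.
  by rewrite w1E uw1 bformC w1E uw0 /a; field.
have hw1 : weight_vector w1 (wt i).
  move=> A TA; rewrite mulmxBl hw0 // -scalemxAl hu // scalerBr !scalerA.
  congr (_ - _ *: _); rewrite /a.
  have [->|n0] := eqVneq (bform w0 w0) 0; first by rewrite !mul0r mulr0.
  rewrite mulrC; congr (_ * _).
  have e1 := weight_pair hw0 hw0 n0 TA.
  have e2 : lam A * wt i A = 1 by apply: (weight_pair hu hw0); rewrite ?uw0 ?oner_eq0.
  have wi0 : wt i A != 0.
    by apply/eqP => zz; move: e1; rewrite zz mulr0 => /esym/eqP; rewrite oner_eq0.
  by apply: (mulIf wi0); rewrite e1 e2.
have w1O l : (l < m)%N -> bform w1 (v l) = 0 /\ bform w1 (w l) = 0.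
  move=> lm; have [uv uw] := hO l lm.
  by rewrite !w1E uv uw !(bformZl _^-1) hproj_orthv ?hproj_orthw // !mulr0 !subr0.
exists (fun k => if k == m then u else v k), (fun k => if k == m then w1 else w k).
have [hW hB] := hvw; split=> [k|k l]; rewrite !ltnS.
  have [-> _|nk] := eqVneq k m; first by split; [exists lam|exists (wt i)].
  by rewrite leq_eqVlt (negbTE nk) => /hW.
have [->|nk] := eqVneq k m; have [->|nl] := eqVneq l m => // km lm.
- have lm' : (l < m)%N by rewrite ltn_neqAle nl.
  have [-> ->] := hO l lm'; have [_ ->] := w1O l lm'.
  by [].
- have km' : (k < m)%N by rewrite ltn_neqAle nk.
  rewrite bformC (bformC (w k)) (bformC (v k) w1).
  have [-> _] := hO k km'; have [-> ->] := w1O k km'.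
  by rewrite (ltn_eqF km').
by apply: hB; rewrite ltn_neqAle ?nk ?nl.
Qed.

End Step.

Lemma hyperbolic_family_exists m : (m + m <= N)%N ->
  exists v w : nat -> 'rV[K]_N, hyperbolic_family m v w.
Proof.
elim: m => [|m IHm] mN; first by exists (fun=> 0), (fun=> 0); split.
have [|v [w hvw]] := IHm; first by lia.
by apply: (hyperbolic_step hvw); lia.
Qed.

(** The basis is v_0, ..., v_(n-1), w_(n-1), ..., w_0. *)
Lemma hyperbolic_basis n : N = (n + n)%N ->
  exists Q : 'M[K]_N, [/\ Q \in unitmx,
    Q *m F *m Q^T = hyperbolic_mx K N &
    forall A, T A -> is_diag_mx (Q *m A *m invmx Q)].
Proof.
move=> eN; have [|v [w [hW hB]]] := @hyperbolic_family_exists n; first by rewrite eN.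
pose q (i : 'I_N) := if (i < n)%N then v i else w (rev_ord i).
have lrev (i : 'I_N) : (i < n)%N = false -> (rev_ord i < n)%N.
  by move=> /= ; have := ltn_ord i; lia.
pose Q := \matrix_i q i.
have QF : Q *m F *m Q^T = hyperbolic_mx K N.
  apply/matrixP => i j; rewrite bform_row !rowK [RHS]mxE /q.
  have li := ltn_ord i; have lj := ltn_ord j.
  case hi: (i < n)%N; case hj: (j < n)%N.
  - have [-> _ _] := hB i j hi hj.
    by rewrite -val_eqE /= (_ : (_ == _ :> nat) = false) //; lia.
  - have [_ _ ->] := hB i (rev_ord j) hi (lrev j hj).
    by rewrite -val_eqE /=; congr (_%:R); lia.
  - rewrite bformC; have [_ _ ->] := hB j (rev_ord i) hj (lrev i hi).
    by rewrite -val_eqE /=; congr (_%:R); lia.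
  - have [_ -> _] := hB (rev_ord i) (rev_ord j) (lrev i hi) (lrev j hj).
    by rewrite -val_eqE /= (_ : (_ == _ :> nat) = false) //; lia.
have uQ : Q \in unitmx.
  suff : Q *m (F *m Q^T *m hyperbolic_mx K N) = 1%:M.
    by move/mulmx1_unit => [].
  rewrite !mulmxA QF; apply/matrixP => i j; rewrite !mxE.
  rewrite (bigD1 (rev_ord i)) //= !mxE eqxx mul1r rev_ordK big1 ?addr0 1?eq_sym //.
  by move=> k nk; rewrite mxE (negbTE nk) mul0r.
exists Q; split=> // A TA.
have hq i : exists c, q i *m A = c *: q i.
  rewrite /q; case hi: (i < n)%N.
    by have [[l hl] _] := hW i hi; exists (l A); apply: hl.
  by have [_ [l hl]] := hW (rev_ord i) (lrev i hi); exists (l A); apply: hl.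
have [c hc] := choice hq.
suff -> : Q *m A = diag_mx (\row_i c i) *m Q by rewrite mulmxK // diag_mx_is_diag.
by apply/row_matrixP => i; rewrite !row_mul row_diag_mx !rowK hc mxE -scalemxAl -rowE rowK.
Qed.

End Hyperbolic.

(** * The special orthogonal group in a hyperbolic basis *)

(** The group SO E of a real form E is the case of the complexification of E. *)
Definition SOform (K : fieldType) N (E : 'M[K]_N) : set 'M[K]_N :=
  [set A | \det A = 1 /\ A^T *m E *m A = E].

Section HyperbolicCoordinates.
Context (K : numClosedFieldType) (n N : nat) (E Q : 'M[K]_N).
Hypothesis evenN : N = (n + n)%N.
Hypothesis unitE : E \in unitmx.
Hypothesis unitQ : Q \in unitmx.
Local Notation p := (@rev_ord N).
Local Notation H := (hyperbolic_mx K N).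
Hypothesis hypQ : Q *m invmx E *m Q^T = H.
Implicit Types (A B C D X : 'M[K]_N) (R : rel 'I_N).

(** The matrix of A in the hyperbolic basis, which consists of the rows of Q. *)
Definition cj A : 'M[K]_N := Q *m A *m invmx Q.

Lemma cjM A B : cj (A *m B) = cj A *m cj B.
Proof. by rewrite /cj !mulmxA mulmxKV. Qed.

Lemma cj1 : cj 1%:M = 1%:M.
Proof. by rewrite /cj mulmx1 mulmxV. Qed.

Lemma cjD A B : cj (A + B) = cj A + cj B.
Proof. by rewrite /cj mulmxDr mulmxDl. Qed.

Lemma cjZ a A : cj (a *: A) = a *: cj A.
Proof. by rewrite /cj -scalemxAr -scalemxAl. Qed.

Definition uncj C : 'M[K]_N := invmx Q *m C *m Q.

Lemma uncjK C : cj (uncj C) = C.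
Proof. by rewrite /cj /uncj !mulmxA mulmxV // mul1mx mulmxK. Qed.

Lemma cjK A : uncj (cj A) = A.
Proof. by rewrite /cj /uncj !mulmxA mulVmx // mul1mx mulmxKV. Qed.

Lemma det_cj A : \det (cj A) = \det A.
Proof.
rewrite /cj !det_mulmx det_inv mulrAC mulfV ?mul1r //.
by rewrite -unitfE -unitmxE.
Qed.

Lemma polymap_cj : polymap cj.
Proof.
apply: polymap_mul; last exact: polymap_const.
by apply: polymap_mul; [exact: polymap_const | exact: polymap_id].
Qed.

Lemma mulmx_hyp C i j : (C *m H) i j = C i (p j).
Proof.
rewrite mxE (bigD1 (p j)) //= big1 => [|k nk]; rewrite mxE.
  by rewrite rev_ordK eqxx mulr1 addr0.
rewrite (_ : (j == p k) = false) ?mulr0 //.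
by apply/negbTE; apply: contraNneq nk => ->; rewrite rev_ordK.
Qed.

Lemma mul_hyp_mx C i j : (H *m C) i j = C (p i) j.
Proof.
rewrite mxE (bigD1 (p i)) //= big1 => [|k nk]; rewrite mxE.
  by rewrite eqxx mul1r addr0.
by rewrite (negbTE nk) mul0r.
Qed.

Lemma hypE C D i j : (C *m H *m D^T) i j = \sum_k C i k * D j (p k).
Proof.
rewrite -mulmxA mxE; apply: eq_bigr => k _.
by rewrite mul_hyp_mx mxE.
Qed.

Lemma hypK : H *m H = 1%:M.
Proof.
by apply/matrixP => i j; rewrite mulmx_hyp !mxE eq_sym (inj_eq rev_ord_inj).
Qed.

Lemma hyp_det_sq C : C *m H *m C^T = H -> \det C * \det C = 1.
Proof.
move=> /(congr1 determinant); rewrite !det_mulmx det_tr mulrAC => e.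
have dH : \det H != 0 :> K.
  have := congr1 determinant hypK; rewrite det_mulmx det1 => e'.
  by apply/eqP => z; move: e'; rewrite z mul0r => /esym/eqP; rewrite oner_eq0.
by apply: (mulIf dH); rewrite e mul1r.
Qed.

Lemma SOform_dual A : A^T *m E *m A = E -> A *m invmx E *m A^T = invmx E.
Proof.
move=> hA; apply: (can_inj (mulKmx unitE)); rewrite mulmxV // !mulmxA; apply: mulmx1C.
by rewrite !mulmxA hA mulmxV.
Qed.

Lemma SOP A : SOform E A <-> \det A = 1 /\ cj A *m H *m (cj A)^T = H.
Proof.
have unitGE : invmx E \in unitmx by rewrite unitmx_inv.
have uQt : Q^T \in unitmx by rewrite unitmx_tr.
have key : cj A *m H *m (cj A)^T = Q *m (A *m invmx E *m A^T) *m Q^T.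
  by rewrite -hypQ /cj !trmx_mul trmx_inv !mulmxA mulmxKV // mulmxK.
split=> -[dA hA]; split=> //; first by rewrite key -hypQ SOform_dual.
apply: (can_inj (mulKmx unitGE)); rewrite mulVmx // !mulmxA; apply: mulmx1C.
apply: (can_inj (mulmxK unitGE)); rewrite mul1mx !mulmxA mulmxK //.
by move: hA; rewrite key -hypQ => /(can_inj (mulmxK uQt)) /(can_inj (mulKmx unitQ)).
Qed.

Lemma cj_formr A : SOform E A -> forall i j, \sum_k cj A i k * cj A j (p k) = (j == p i)%:R.
Proof. by move=> /SOP [_ hA] i j; rewrite -hypE hA mxE. Qed.

(** The inverse is the adjoint for the form, that is, the reflection in the antidiagonal.
    This is why the conditions cut out by p-symmetric relations define subgroups. *)
Lemma cj_inv A i j : SOform E A -> cj (invmx A) i j = cj A (p j) (p i).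
Proof.
move=> SA; have [dA hA] := (SOP A).1 SA.
have uA : A \in unitmx by rewrite unitmxE dA unitr1.
have -> : cj (invmx A) = H *m (cj A)^T *m H.
  apply: (can_inj (mulKmx (_ : cj A \in unitmx))).
    by rewrite unitmxE det_cj dA unitr1.
  by rewrite -cjM mulmxV // cj1 !mulmxA hA hypK.
by rewrite mulmx_hyp mul_hyp_mx mxE.
Qed.

Lemma SOform_unit A : SOform E A -> A \in unitmx.
Proof. by case=> dA _; rewrite unitmxE dA unitr1. Qed.

Lemma SOform1 : SOform E 1%:M.
Proof. by split; rewrite ?det1 // trmx1 mul1mx mulmx1. Qed.

Lemma SOformM A B : SOform E A -> SOform E B -> SOform E (A *m B).
Proof.
move=> [dA hA] [dB hB]; split; first by rewrite det_mulmx dA dB mulr1.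
by rewrite trmx_mul !mulmxA -(mulmxA _ _ E) -(mulmxA _ _ A) hA.
Qed.

Lemma SOformV A : SOform E A -> SOform E (invmx A).
Proof.
move=> SA; have uA := SOform_unit SA; case: SA => dA hA.
split; first by rewrite det_inv dA invr1.
rewrite -[in LHS]hA trmx_inv !mulmxA mulVmx ?unitmx_tr // mul1mx.
by rewrite mulmxK.
Qed.

(** For a preorder R reversed by the symmetry p, these are the elements of SO which
    stabilize the coordinate subspaces attached to the up-sets of R. *)
Definition SOstab R : set 'M[K]_N :=
  [set A | SOform E A /\ forall i j, ~~ R i j -> cj A i j = 0].

Lemma SOstab_subgroup R : reflexive R -> transitive R ->
  (forall i j, R (p j) (p i) = R i j) -> mx_subgroup (SOstab R).
Proof.
move=> rR tR pR; split.
- by move=> A [/SOform_unit].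
- split=> [|i j nR]; first exact: SOform1.
  rewrite cj1 // mxE; case: eqP nR => // ->; by rewrite rR.
- move=> A B [SA hA] [SB hB]; split=> [|i j nR]; first exact: SOformM.
  rewrite cjM // mxE big1 // => k _.
  have [Rik|/hA ->] := boolP (R i k); last by rewrite mul0r.
  rewrite hB ?mulr0 //; apply: contra nR; exact: tR.
- move=> A [SA hA]; split=> [|i j nR]; first exact: SOformV.
  by rewrite (cj_inv) // hA // pR.
Qed.

Lemma SOstab_closed R : zclosed (SOstab R).
Proof.
apply/zclosedP.
pose F1 := [set f : 'M[K]_N -> K | f = fun A => \det A - 1].
pose F2 := [set f : 'M[K]_N -> K | exists i j, f = fun A => (A^T *m E *m A - E) i j].
pose F3 := [set f : 'M[K]_N -> K | exists i j, ~~ R i j /\ f = fun A => cj A i j].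
exists (F1 `|` F2 `|` F3); split.
  move=> f [[->|[i [j ->]]]|[i [j [_ ->]]]].
  - by apply: polyfunB; [apply: polyfun_det; apply: polymap_id|apply: polyfun_const].
  - apply: polymapB; last exact: polymap_const.
    apply: polymap_mul; last exact: polymap_id.
    by apply: polymap_mul; [apply: polymap_tr; exact: polymap_id|exact: polymap_const].
  - exact: polymap_cj.
apply/seteqP; split=> A.
  move=> [SA hA]; split; first exact: SOform_unit.
  case: SA => dA eA f [[->|[i [j ->]]]|[i [j [nR ->]]]].
  - by rewrite dA subrr.
  - by rewrite eA subrr mxE.
  - exact: hA.
move=> [uA hA]; split; last first.
  move=> i j nR; apply: (hA (fun A => cj A i j)); right; by exists i, j.
split.
  by apply/eqP; rewrite -subr_eq0; apply/eqP; apply: (hA (fun A => \det A - 1)); left; left.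
apply/eqP; rewrite -subr_eq0; apply/eqP/matrixP => i j; rewrite [RHS]mxE.
by apply: (hA (fun A => (A^T *m E *m A - E) i j)); left; right; exists i, j.
Qed.

Lemma SOstabS R R' : subrel R R' -> SOstab R `<=` SOstab R'.
Proof. by move=> sR A [SA hA]; split=> // i j nR; apply: hA; apply: contra nR; apply: sR. Qed.

(** * The diagonal torus *)

Definition dm (t : 'I_N -> K) : 'M[K]_N := uncj (diag_mx (\row_i t i)).

Lemma cj_dm t i j : cj (dm t) i j = t i *+ (i == j).
Proof. by rewrite uncjK // !mxE. Qed.

Definition torus_coords (t : 'I_N -> K) : Prop := forall i, t i * t (p i) = 1.

(** p has no fixed point, so the indices are paired off by p. *)
Lemma prod_pairs (t : 'I_N -> K) : torus_coords t -> \prod_i t i = 1.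
Proof.
move=> ht; rewrite (bigID (fun i : 'I_N => (i < n)%N)) /=.
rewrite [X in _ * X](reindex_inj rev_ord_inj) /=.
rewrite [X in _ * X](eq_bigl (fun i : 'I_N => (i < n)%N)) => [|i]; last first.
  by have := ltn_ord i => /= li; lia.
by rewrite -big_split big1 //= => i _; apply: ht.
Qed.

Lemma dm_SO t : torus_coords t -> SOform E (dm t).
Proof.
move=> ht; apply/(SOP); split.
  rewrite -(det_cj) uncjK // det_diag -[RHS](prod_pairs ht).
  by apply: eq_bigr => i _; rewrite mxE.
apply/matrixP => i j; rewrite hypE (bigD1 i) //= big1 => [|k nk]; last first.
  by rewrite cj_dm eq_sym (negbTE nk) mul0r.
rewrite !cj_dm eqxx addr0 !mxE; have [->|_] := eqVneq j (p i); first by rewrite ?eqxx ht.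
by rewrite mulr0n mulr0.
Qed.

Definition SOtorus : set 'M[K]_N := SOstab eq_op.

Lemma dm_torus t : torus_coords t -> SOtorus (dm t).
Proof.
move=> ht; split=> [|i j nij]; first exact: dm_SO.
by rewrite cj_dm (negbTE nij).
Qed.

Lemma torus_dm A : SOtorus A -> exists2 t, torus_coords t & A = dm t.
Proof.
move=> [SA hA]; exists (fun i => cj A i i) => [i|].
  have := cj_formr SA i (p i).
  rewrite eqxx (bigD1 i) //= big1 ?addr0 // => k nk.
  by rewrite hA ?mul0r // eq_sym.
rewrite /dm -[LHS](cjK); congr uncj; apply/matrixP => i j.
by rewrite [RHS]mxE [X in X *+ _]mxE; case: eqVneq => [->//|nij]; apply: hA.
Qed.

Lemma torus_subgroup : mx_subgroup SOtorus.
Proof.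
apply: SOstab_subgroup => [i //|i j k /eqP -> //|i j].
by rewrite (inj_eq rev_ord_inj) eq_sym.
Qed.

Lemma torus_comm A B : SOtorus A -> SOtorus B -> A *m B = B *m A.
Proof.
move=> /torus_dm [t _ ->] /torus_dm [u _ ->].
rewrite -(cjK (_ *m dm u)) -(cjK (_ *m dm t)); congr uncj.
rewrite (cjM (dm t)) (cjM (dm u)) /dm !(uncjK).
by apply/matrixP => i j; rewrite !mul_diag_mx !mxE; case: eqP => [->|_]; rewrite ?mulr0 // mulrC.
Qed.

(** The curve joining an element to 1 has coordinates which move linearly on one
    half of the basis, and inversely to them on the other half. *)
Lemma torus_linked S t : SOtorus `<=` S -> torus_coords t -> zlinked S (dm t) 1%:M.
Proof.
move=> TS ht.
pose l (i : 'I_N) : {poly K} := 1 + 'X * (t i - 1)%:P.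
pose d := \prod_(i : 'I_N | (i < n)%N) l i.
pose u (s : K) (i : 'I_N) := if (i < n)%N then (l i).[s] else (l (p i)).[s]^-1.
have lt0 i : t i != 0.
  by apply/eqP => z; have := ht i; rewrite z mul0r => /esym/eqP; rewrite oner_eq0.
have lE i s : (l i).[s] = 1 + s * (t i - 1) by rewrite /l !hornerE.
have l0 i : (l i).[0] = 1 by rewrite lE mul0r addr0.
have l1 i : (l i).[1] = t i by rewrite lE mul1r subrKC.
have u0 : dm (u 0) = 1%:M.
  rewrite /dm -(cjK 1%:M) cj1 //; congr uncj; apply/matrixP => i j.
  by rewrite !mxE /u !l0 invr1 if_same.
have u1 : dm (u 1) = dm t.
  congr dm; apply/funext => i; rewrite /u !l1.
  case: ifP => // _; apply: (mulIf (lt0 (p i))); by rewrite mulVf // ht.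
have dE s : d.[s] = \prod_(i : 'I_N | (i < n)%N) (l i).[s] by rewrite horner_prod.
have d0 : d.[0] != 0.
  by rewrite dE; apply/prodf_neq0 => i _; rewrite l0 oner_eq0.
have d1 : d.[1] != 0.
  by rewrite dE; apply/prodf_neq0 => i _; rewrite l1.
rewrite -u0 -u1; apply: (zlinked_ratcurve (gam := fun s => dm (u s)) _ _ d1 d0); last first.
  move=> s; rewrite dE => /prodf_neq0 hs; apply/TS/dm_torus => i; rewrite /u rev_ordK.
  have li := ltn_ord i; have -> : (p i < n)%N = ~~ (i < n)%N by move=> /=; lia.
  case hi: (i < n)%N => /=; first by rewrite mulfV // hs.
  by rewrite mulVf // hs //=; lia.
have ratl i : ratfun d (fun s => u s i).
  rewrite /u; case hi: (i < n)%N; first by exists 0%N, (l i) => s _; rewrite expr0 mul1r.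
  have hp : (p i < n)%N by have := ltn_ord i => /= li; lia.
  exists 1%N, (\prod_(j : 'I_N | (j < n)%N && (j != p i)) l j) => s; rewrite expr1 dE.
  move/prodf_neq0 => hs; rewrite (bigD1 (p i)) //= horner_prod mulrAC mulfV ?mul1r //.
  exact: hs.
have pf i j : polyfun (fun C => uncj C i j).
  apply: polymap_mul; last exact: polymap_const.
  by apply: polymap_mul; [exact: polymap_const|exact: polymap_id].
move=> i j; apply: (polyfun_ratcurve (gam := fun s => diag_mx (\row_k u s k))) (pf i j).
move=> k l'; have [->|nkl] := eqVneq k l'.
  have [e [q hq]] := ratl l'; exists e, q => s ds.
  by rewrite !mxE eqxx mulr1n hq.
by exists 0%N, 0 => s _; rewrite !mxE (negbTE nkl) mulr0n mulr0 horner0.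
Qed.

Lemma torus_connected : zconnected SOtorus.
Proof.
apply: (@zconnected_linked _ _ _ 1%:M); first by case: torus_subgroup.
by move=> _ /torus_dm [t ht ->]; apply: torus_linked.
Qed.

Lemma torus_is_torus : is_torus SOtorus.
Proof.
split; first by split; [exact: torus_subgroup|exact: SOstab_closed|exact: torus_connected].
exists Q => // A [_ hA]; apply/is_diag_mxP => i j nij; exact: hA.
Qed.

(** * The Borel subgroup of a height function *)

Section Height.
(** A strict ordering of the weights of the torus, antisymmetric under inversion. *)
Variable c : 'I_N -> int.
Hypothesis c_inj : injective c.
Hypothesis c_rev : forall i, c (p i) = - c i.

Definition SOborel : set 'M[K]_N := SOstab (fun i j => c i <= c j).

Lemma SOborel_subgroup : mx_subgroup SOborel.
Proof.
apply: SOstab_subgroup => [i|i j k|i j]; first exact: lexx.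
  exact: le_trans.
by rewrite !c_rev lerN2.
Qed.

Lemma torus_sub_borel : SOtorus `<=` SOborel.
Proof. by apply: SOstabS => i j /eqP ->; rewrite lexx. Qed.

(** Conjugation by a cocharacter of the torus contracts each matrix of SOborel to its
    diagonal, along the polynomial curve C. *)
Lemma SOborel_connected : zconnected SOborel.
Proof.
have B1 : SOborel 1%:M by case: SOborel_subgroup.
apply: (zconnected_linked B1) => A [SA hA].
pose q i j : {poly K} := 'X^`|c j - c i|%N * (cj A i j)%:P.
pose C s : 'M[K]_N := \matrix_(i, j) (q i j).[s].
have CE s i j : C s i j = s ^+ `|c j - c i|%N * cj A i j.
  by rewrite mxE /q !hornerE.
have form s : C s *m H *m (C s)^T = H.
  apply/matrixP => i j; rewrite hypE.
  transitivity (\sum_k s ^+ `|- (c j + c i)|%N * (cj A i k * cj A j (p k))).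
    apply: eq_bigr => k _; rewrite !CE mulrACA.
    have [ik|/hA ->] := boolP (c i <= c k); last by rewrite mul0r !mulr0.
    have [jk|/hA ->] := boolP (c j <= c (p k)); last by rewrite !mulr0.
    congr (_ * _); rewrite -exprD; congr (_ ^+ _); rewrite c_rev in jk *; lia.
  rewrite -mulr_sumr (cj_formr SA) mxE.
  have [->|_] := eqVneq j (p i); last by rewrite mulr0.
  by rewrite c_rev addNr oppr0 expr0 mulr1.
have C1 : C 1 = cj A by apply/matrixP => i j; rewrite CE expr1n mul1r.
(* The determinant is a polynomial in s whose square is 1, hence a constant. *)
have detC s : \det (C s) = 1.
  have pdet : polyfun (fun X : 'M[K]_N => \det X).
    by apply: polyfun_det; apply: polymap_id.
  have [|r hr] := polyfun_curve (gam := C) (q := q) _ pdet.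
    by move=> x i j; rewrite mxE.
  have sq : r * r = 1.
    apply: poly_fun_eq => x; rewrite hornerM -hr hornerC.
    exact: hyp_det_sq.
  have szr : size r == 1%N.
    have r0 : r != 0 by apply/eqP => z; move: sq; rewrite z mul0r => /esym/eqP; rewrite oner_eq0.
    have sr : size r != 0%N by rewrite size_poly_eq0.
    have e : size (r * r) = 1%N by rewrite sq size_poly1.
    by rewrite size_mul // in e; case: (size r) e sr => [//|[//|k]]; rewrite addSn addnS.
  have [a _ ra] := size_poly1P r szr.
  by have := hr 1; rewrite [in X in _ -> X]hr C1 det_cj // SA.1 ra !hornerC.
have BC s : SOborel (uncj (C s)).
  split=> [|i j nij]; last by rewrite uncjK // CE hA ?mulr0.
  by apply/(SOP); rewrite -(det_cj) uncjK.
have AE : uncj (C 1) = A.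
  by transitivity (uncj (cj A)); [congr uncj; exact: C1|exact: cjK].
rewrite -[X in zlinked _ X _]AE.
have TC0 : SOtorus (uncj (C 0)).
  split=> [|i j nij]; first by case: (BC 0).
  rewrite uncjK // CE expr0n (_ : (_ == 0)%N = false) ?mul0r //.
  by rewrite absz_eq0 subr_eq0 (inj_eq c_inj) eq_sym; apply: negbTE.
apply: (@zlinked_trans _ _ _ _ (uncj (C 0))).
  have pu i j : polyfun (fun X : 'M[K]_N => uncj X i j).
    apply: polymap_mul; last exact: polymap_const.
    by apply: polymap_mul; [exact: polymap_const|exact: polymap_id].
  have hr i j : exists r : {poly K}, forall s, uncj (C s) i j = r.[s].
    apply: (polyfun_curve (gam := C) (q := q) _ (pu i j)) => s k l.
    by rewrite mxE.
  have hr2 i : exists f : 'I_N -> {poly K}, forall j s, uncj (C s) i j = (f j).[s].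
    by have [f hf] := choice (hr i); exists f.
  have [r hr'] := choice hr2.
  by apply: (zlinked_curve (gam := fun s => uncj (C s)) (q := r)).
have [t ht ->] := torus_dm TC0; apply: torus_linked => //; exact: torus_sub_borel.
Qed.

Definition raises (k : nat) C : Prop := forall i j, ~~ (c i + k%:Z <= c j) -> C i j = 0.

Lemma raisesD k C D : raises k C -> raises k D -> raises k (C + D).
Proof. by move=> hC hD i j h; rewrite mxE hC // hD // addr0. Qed.

Lemma raisesN k C : raises k C -> raises k (- C).
Proof. by move=> hC i j h; rewrite mxE hC // oppr0. Qed.

Lemma raisesM k l C D : raises k C -> raises l D -> raises (k + l) (C *m D).
Proof.
move=> hC hD i j h; rewrite mxE big1 // => m _.
have [im|/hC ->] := boolP (c i + k%:Z <= c m); last by rewrite mul0r.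
by rewrite hD ?mulr0 //; apply: contra h => mj; lia.
Qed.

Lemma raises_le k l C : (k <= l)%N -> raises l C -> raises k C.
Proof. by move=> kl hC i j h; apply: hC; apply: contra h => h; lia. Qed.

Lemma SOborel_raises A : SOborel A -> raises 0 (cj A).
Proof. by case=> _ hA i j h; apply: hA; rewrite addr0 in h. Qed.

(** The k-th derived group of SOborel is contained in SOunip k: for A and B in SOunip k.+1,
    A B - B A = (A - 1) (B - 1) - (B - 1) (A - 1) raises the height twice as much. *)
Definition SOunip k : set 'M[K]_N := [set A | SOborel A /\ raises k (cj A - 1%:M)].

Let gB : mx_subgroup SOborel := SOborel_subgroup.

Lemma SOunip_subgroup k : mx_subgroup (SOunip k).
Proof.
have [uB B1 BM BV] := gB; split.
- by move=> A [/uB].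
- by split=> // i j _; rewrite cj1 // subrr mxE.
- move=> A B [BA hA] [BB hB]; split; first exact: BM.
  have -> : cj (A *m B) - 1%:M = (cj A - 1%:M) *m cj B + (cj B - 1%:M).
    by rewrite cjM // mulmxBl mul1mx addrA subrK.
  apply: raisesD => //; rewrite -(addn0 k); apply: raisesM => //; exact: SOborel_raises.
- move=> A [BA hA]; split; first exact: BV.
  have -> : cj (invmx A) - 1%:M = - ((cj A - 1%:M) *m cj (invmx A)).
    by rewrite mulmxBl mul1mx -cjM // mulmxV ?cj1 ?opprB //; apply: uB.
  apply: raisesN; rewrite -(addn0 k); apply: raisesM => //.
  by apply: SOborel_raises; apply: BV.
Qed.

(** The commutator minus 1 is (A B - B A) A^-1 B^-1. *)
Lemma SOunip_commutator k A B : SOborel A -> SOborel B ->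
  raises k (cj A *m cj B - cj B *m cj A) -> SOunip k (A *m B *m invmx A *m invmx B).
Proof.
move=> BA BB h; have [uB B1 BM BV] := gB.
have [uA uB'] := (uB _ BA, uB _ BB); rewrite /= in uA uB'.
split; first exact: (BM _ _ (BM _ _ (BM _ _ BA BB) (BV _ BA)) (BV _ BB)).
have -> : cj (A *m B *m invmx A *m invmx B) - 1%:M =
    (cj A *m cj B - cj B *m cj A) *m (cj (invmx A) *m cj (invmx B)).
  rewrite -!cjM // mulmxBl -!cjM // !mulmxA; congr (_ - _).
  by rewrite mulmxK // mulmxV // cj1.
rewrite -(addn0 k); apply: raisesM => //.
by apply: (raisesM (k := 0) (l := 0)); apply: SOborel_raises; apply: BV.
Qed.

(** For triangular A and B, the products A B and B A have the same diagonal. *)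
Lemma derived_borel_unip : mx_derived SOborel `<=` SOunip 1.
Proof.
apply: derived_least; first exact: SOunip_subgroup.
move=> A B BA BB; apply: SOunip_commutator => // i j h.
have [rA rB] := (SOborel_raises BA, SOborel_raises BB).
have [lij|nij] := boolP (c i <= c j); last first.
  have r0 C D : raises 0 C -> raises 0 D -> (C *m D) i j = 0.
    by move=> rC rD; apply: (raisesM (k := 0) (l := 0) rC rD); rewrite addr0.
  by rewrite mxE [X in _ + X]mxE (r0 _ _ rA rB) (r0 _ _ rB rA) subr0.
have eij : j = i by apply: c_inj; lia.
have diag C D : raises 0 C -> raises 0 D -> (C *m D) i i = C i i * D i i.
  move=> rC rD; rewrite mxE (bigD1 i) //= big1 ?addr0 // => k nk.
  have [ik|h1] := boolP (c i + 0%:Z <= c k); last by rewrite rC ?mul0r.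
  rewrite rD ?mulr0 //; apply/negP => ki; move/eqP: nk; apply; apply: c_inj; lia.
by rewrite eij mxE [X in _ + X]mxE (diag _ _ rA rB) (diag _ _ rB rA) mulrC subrr.
Qed.

Lemma derived_unip k : mx_derived (SOunip k.+1) `<=` SOunip k.+2.
Proof.
apply: derived_least; first exact: SOunip_subgroup.
move=> A B [BA rA] [BB rB]; apply: SOunip_commutator => //.
have comm1 C D : C *m D - D *m C = (C - 1%:M) *m (D - 1%:M) - (D - 1%:M) *m (C - 1%:M).
  rewrite !(mulmxBl, mulmxBr, mul1mx, mulmx1).
  move: (C *m D) (D *m C) => CD DC; apply/matrixP => i j; rewrite !mxE; ring.
rewrite comm1; apply: (@raises_le _ (k.+1 + k.+1)); first lia.
by apply: raisesD; first exact: raisesM; apply: raisesN; exact: raisesM.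
Qed.

Lemma SOborel_solvable : mx_solvable SOborel.
Proof.
have H m : iter m.+1 (@mx_derived K N) SOborel `<=` SOunip m.+1.
  elim: m => [|m IHm]; first exact: derived_borel_unip.
  by apply: (subset_trans (derived_mono IHm)); exact: derived_unip.
(* No difference of heights reaches M + 1. *)
pose M := (\sum_i (`|c i| + `|c i|))%N.
exists M.+1 => A /H [_ hA] /=.
rewrite -(cjK A) -(cjK 1%:M) cj1 //; congr uncj.
apply/eqP; rewrite -subr_eq0; apply/eqP/matrixP => i j; rewrite hA ?mxE //.
have ci k : (`|c k| + `|c k| <= M)%N by rewrite /M (bigD1 k) //= leq_addr.
by have := ci i; have := ci j; lia.
Qed.

End Height.
(** * Root vectors *)

(** The torus elements tau j separate the weight j from the others, and even its square
    from the products of two others (tau_coords_sq). *)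
Definition tau_coords (j k : 'I_N) : K := if k == j then 2 else if k == p j then 2^-1 else 1.

Lemma tau_coordsP j : torus_coords (tau_coords j).
Proof.
move=> k; rewrite /tau_coords (inj_eq rev_ord_inj).
have [->|nkj] := eqVneq k j; first by rewrite (negbTE (rev_ord_neq evenN j)) mulfV ?pnatr_eq0.
have [->|nkpj] := eqVneq k (p j); first by rewrite rev_ordK eqxx mulVf ?pnatr_eq0.
rewrite (_ : (p k == j) = false) ?mulr1 //.
by apply/negbTE; apply: contraNneq nkpj => <-; rewrite rev_ordK.
Qed.

Definition tau j : 'M[K]_N := dm (tau_coords j).

Lemma tau_torus j : SOtorus (tau j).
Proof. exact: (dm_torus (tau_coordsP j)). Qed.

Lemma tau_coords_sq j i k : i != j -> k != j -> tau_coords j i * tau_coords j k != 2 * 2.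
Proof.
move=> nij nkj.
have small l : l != j -> (0 <= tau_coords j l) && (tau_coords j l <= 1).
  move=> nl; rewrite /tau_coords (negbTE nl); case: ifP => _; last by rewrite ler01 lexx.
  by rewrite invr_ge0 ler0n invf_le1 ?ltr0n // ler1n.
have [/andP[i0 i1] /andP[k0 k1]] := (small i nij, small k nkj).
apply/eqP => e; have := mulr_ile1 i0 k0 i1 k1.
by rewrite e -natrM (ler_nat _ 4 1).
Qed.

(** Conjugating by the torus multiplies the (i, j) entry by the ratio of two coordinates. *)
Lemma root_space_coords S a X t i j : root_space SOtorus S a X -> torus_coords t ->
  cj X i j != 0 -> t i = a (dm t) * t j.
Proof.
move=> [_ hX] ht nz; have Tt := dm_torus ht.
have ut : dm t \in unitmx by case: Tt => /SOform_unit.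
have e : cj (dm t) *m cj X = a (dm t) *: cj X *m cj (dm t).
  by rewrite -cjZ -!cjM // -hX // mulmxKV.
have cd : cj (dm t) = diag_mx (\row_k t k) by exact: uncjK.
rewrite cd in e; move: (cj X) e nz => Y /(congr1 (fun M : 'M[K]_N => M i j)).
rewrite mul_diag_mx mul_mx_diag !mxE => e nz; apply: (mulIf nz).
by rewrite e mulrAC.
Qed.

(** A nonzero diagonal entry would force the weight a to be trivial. *)
Lemma root_vector_offdiag S a X i : root_space SOtorus S a X ->
  (exists2 t, SOtorus t & a t != 1) -> cj X i i = 0.
Proof.
move=> rX [t /(torus_dm) [u hu ->] at1].
apply/eqP/negPn/negP => nz; have e := root_space_coords rX hu nz.
have ui : u i != 0.
  by apply/eqP => z; have := hu i; rewrite z mul0r => /esym/eqP; rewrite oner_eq0.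
by move/eqP: at1; apply; apply: (mulIf ui); rewrite -e mul1r.
Qed.

(** A product X i j * X j k of nonzero entries would force t_i t_k = t_j^2 on the torus,
    which fails at tau j. *)
Lemma root_vector_square S a X : root_space SOtorus S a X ->
  (exists2 t, SOtorus t & a t != 1) -> X *m X = 0.
Proof.
move=> rX nt; suff e : cj X *m cj X = 0.
  by rewrite -(cjK (X *m X)) cjM // e /uncj mulmx0 mul0mx.
apply/matrixP => i k; rewrite mxE [RHS]mxE big1 // => j _.
have [->|nij] := eqVneq (cj X i j) 0; first by rewrite mul0r.
have [->|njk] := eqVneq (cj X j k) 0; first by rewrite mulr0.
have hi : i != j by apply: contraNneq nij => ->; rewrite (root_vector_offdiag _ rX nt).
have hk : k != j by apply: contraNneq njk => ->; rewrite (root_vector_offdiag _ rX nt).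
have e1 := root_space_coords rX (tau_coordsP j) nij.
have e2 := root_space_coords rX (tau_coordsP j) njk.
have tj : tau_coords j j = 2 by rewrite /tau_coords eqxx.
by have := tau_coords_sq hi hk; rewrite e1 mulrAC -e2 tj eqxx.
Qed.

Lemma form_line Y s : (1%:M + s *: Y) *m H *m (1%:M + s *: Y)^T =
  H + s *: (Y *m H + H *m Y^T) + s ^+ 2 *: (Y *m H *m Y^T).
Proof.
have -> : (1%:M + s *: Y)^T = 1%:M + s *: Y^T.
  by apply/matrixP => i j; rewrite !mxE eq_sym.
rewrite mulmxDr mulmx1 mulmxDl mul1mx -scalemxAl -scalemxAr mulmxDl -scalemxAl.
by rewrite !scalerDr scalerA -expr2 !addrA.
Qed.

Lemma Lie_form X i j : mx_Lie (SOform E) X -> cj X i j = - cj X (p j) (p i).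
Proof.
move=> LX; apply/eqP; rewrite -addr_eq0; apply/eqP.
pose f A := (cj A *m H *m (cj A)^T - H) i (p j).
pose q : {poly K} := ((cj X *m H *m (cj X)^T) i (p j))%:P.
apply: (@mx_Lie_polyfun _ _ _ X f _ q LX) => [|A /(SOP) [_ hA]|s].
- apply: polymapB; last exact: polymap_const.
  apply: polymap_mul; last by apply: polymap_tr; apply: polymap_cj.
  by apply: polymap_mul; [exact: polymap_cj|exact: polymap_const].
- by rewrite /f hA subrr mxE.
rewrite /f /q hornerC cjD cjZ cj1 // form_line trmx1 mulmx1 mul1mx.
move: (cj X *m H *m (cj X)^T) => Z.
rewrite subrr [X in _ = X + _ + _]mxE add0r.
rewrite [X in fun_of_matrix X](_ : _ = s *: (cj X *m H + H *m (cj X)^T) + s ^+ 2 *: Z).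
  rewrite mxE [X in X + _]mxE [X in _ + X]mxE; congr (_ * _ + _).
  by rewrite mxE mulmx_hyp mul_hyp_mx rev_ordK [X in _ + X]mxE.
by rewrite addrC !addrA addNr add0r.
Qed.

Lemma Lie_stab R X i j : mx_Lie (SOstab R) X -> i != j -> ~~ R i j -> cj X i j = 0.
Proof.
move=> LX nij nR; pose f A := cj A i j.
apply: (@mx_Lie_polyfun _ _ _ X f _ 0 LX) => [|A [_ hA]|s].
- exact: polymap_cj.
- exact: hA.
rewrite /f cjD cjZ cj1 // horner0 mulr0 addr0.
by rewrite mxE [X in _ + X]mxE.
Qed.

(** The root vector of weight t_i / t_j in the hyperbolic basis. *)
Definition root_coords (i j : 'I_N) : 'M[K]_N := delta_mx i j - delta_mx (p j) (p i).

Definition root_vector i j : 'M[K]_N := uncj (root_coords i j).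

Lemma root_coords_entry i j k l :
  root_coords i j k l = ((k == i) && (l == j))%:R - ((k == p j) && (l == p i))%:R.
Proof. by rewrite !mxE. Qed.

Lemma root_coords_sq i j : i != j -> root_coords i j *m root_coords i j = 0.
Proof.
move=> nij; rewrite mulmxBl !mulmxBr !mul_delta_mx_cond.
rewrite [j == i]eq_sym (negbTE nij) (inj_eq rev_ord_inj) (negbTE nij).
rewrite [j == p j]eq_sym !(negbTE (rev_ord_neq evenN _)).
by rewrite !mulr0n !subrr.
Qed.

Lemma root_coords_form i j s : i != j ->
  (1%:M + s *: root_coords i j) *m H *m (1%:M + s *: root_coords i j)^T = H.
Proof.
move=> nij; set Y := root_coords i j.
have HY : H *m Y^T = - (Y *m H).
  apply/matrixP => k l; rewrite mul_hyp_mx mxE [RHS]mxE mulmx_hyp !root_coords_entry.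
  have e x y : (p x == y) = (x == p y).
    by rewrite -(inj_eq rev_ord_inj) rev_ordK.
  rewrite !e !rev_ordK opprB; by rewrite ![(l == _) && _]andbC.
rewrite form_line HY subrr scaler0 addr0 -mulmxA HY mulmxN mulmxA root_coords_sq //.
by rewrite mul0mx oppr0 scaler0 addr0.
Qed.

Lemma root_vector_Lie R i j : reflexive R -> i != j -> R i j -> R (p j) (p i) ->
  mx_Lie (SOstab R) (root_vector i j).
Proof.
move=> rR nij Rij Rp; apply: mx_Lie_line => s.
have cjE u : cj (1%:M + u *: root_vector i j) = 1%:M + u *: root_coords i j.
  by rewrite cjD cjZ cj1 // uncjK.
split; last first.
  move=> k l nR; rewrite cjE mxE [X in _ + X]mxE root_coords_entry mxE.
  have -> : (k == l) = false by apply: contraNF nR => /eqP ->.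
  have -> : (k == i) && (l == j) = false by apply: contraNF nR => /andP[/eqP -> /eqP ->].
  have -> : (k == p j) && (l == p i) = false.
    by apply: contraNF nR => /andP[/eqP -> /eqP ->].
  by rewrite subrr mulr0 addr0.
apply/(SOP); rewrite -(det_cj) cjE root_coords_form //; split=> //.
(* 1 + s X is the square of 1 + (s/2) X, and isometries have determinant 1 or -1. *)
have -> : 1%:M + s *: root_coords i j =
    (1%:M + (s / 2) *: root_coords i j) *m (1%:M + (s / 2) *: root_coords i j).
  rewrite mulmxDr mulmx1 mulmxDl mul1mx -!scalemxAr -!scalemxAl root_coords_sq //.
  by rewrite !scaler0 addr0 -addrA -scalerDl -splitr.
by rewrite det_mulmx; apply: hyp_det_sq; apply: root_coords_form.
Qed.

Lemma root_vector_weight i j t : j != p i -> torus_coords t ->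
  dm t *m root_vector i j *m invmx (dm t) = (t i / t j) *: root_vector i j.
Proof.
move=> njp ht.
have ut : dm t \in unitmx by have [/SOform_unit] := dm_torus ht.
have t0 k : t k != 0.
  by apply/eqP => z; have := ht k; rewrite z mul0r => /esym/eqP; rewrite oner_eq0.
suff e : dm t *m root_vector i j = (t i / t j) *: root_vector i j *m dm t.
  by rewrite e mulmxK.
rewrite -(cjK (_ *m root_vector _ _)) -(cjK (_ *m dm t)); congr uncj.
have cd : cj (dm t) = diag_mx (\row_k t k) by exact: uncjK.
have cr : cj (root_vector i j) = root_coords i j by exact: uncjK.
rewrite (cjM (dm t)) (cjM (_ *: _)) cjZ cd cr -scalemxAl mul_diag_mx mul_mx_diag.
apply/matrixP => k l; rewrite [LHS]mxE [RHS]mxE [X in _ = _ * X]mxE root_coords_entry !mxE.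
have [[/eqP -> /eqP ->]|] := @andP (k == i) (l == j).
  rewrite (_ : (i == p j) = false) ?andbF ?subr0 ?mulr1 ?mul1r ?mulfVK //.
  by apply: contraNF njp => /eqP ->; rewrite rev_ordK.
move=> _; have [[/eqP -> /eqP ->]|] := @andP (k == p j) (l == p i); last first.
  by rewrite subrr !(mulr0, mul0r).
rewrite sub0r !(mulrN1, mulN1r, mulrN); congr (- _).
apply: (mulIf (t0 j)); rewrite mulrAC mulfVK // (mulrC (t (p j))) ht.
by rewrite ht.
Qed.

(** * Borel subgroups containing the diagonal torus *)

Section BorelFlag.
Variable B : set 'M[K]_N.
Hypothesis gB : mx_subgroup B.
Hypothesis BSO : B `<=` SOform E.
Hypothesis conB : finite_values_constant B.
Hypothesis solB : mx_solvable B.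
Hypothesis TB : SOtorus `<=` B.

(** The spans of the initial segments of s are totally isotropic, and stable under B. *)
Definition stable_flag (s : seq 'I_N) : Prop :=
  [/\ uniq s, (forall i, i \in s -> p i \notin s) &
      forall A i j, B A -> i \in s -> cj A i j != 0 ->
        (j \in s) && (index j s <= index i s)%N].

Lemma cjV_neq0 A i j : B A -> cj A i j != 0 -> cj (invmx A) (p j) (p i) != 0.
Proof.
move=> BA nz; have SA := BSO BA.
by rewrite (cj_inv) // !rev_ordK.
Qed.

(** B acts on W^perp / W, for the span W of the flag, through the coordinates outside
    s and p s; a common eigenvector there is a weight vector of the torus, and as the
    torus has distinct weights it is a coordinate vector. *)
Lemma stable_flag_step s : stable_flag s -> (size s < n)%N ->
  exists i, stable_flag (rcons s i).
Proof.
move=> [us ps fs] sn.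
pose C := [set i : 'I_N | (i \notin s) && (p i \notin s)]%SET.
have C0 : (0 < #|C|)%N.
  rewrite lt0n cards_eq0; apply/negP => /eqP Ce.
  have /(uniq_leq_size (enum_uniq 'I_N)) : {subset enum 'I_N <= s ++ map p s}.
    move=> i _; rewrite mem_cat; have : i \notin C by rewrite Ce inE.
    rewrite inE negb_and !negbK => /orP[-> //|h]; apply/orP; right.
    by rewrite -(rev_ordK i) mem_map //; exact: rev_ord_inj.
  by rewrite size_enum_ord size_cat size_map; move: (size s) sn => x; lia.
have [uB B1 BM BV] := gB.
pose ev := @enum_val _ (mem C).
pose rho A : 'M[K]_#|C| := \matrix_(i, j) cj A (ev i) (ev j).
have evC i : ev i \in C by exact: enum_valP.
have rG : is_polyrep B rho.
  split.
  - move=> i j; apply: eq_polyfun (polymap_cj (ev i) (ev j)) => A; by rewrite [RHS]mxE.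
  - apply/matrixP => i j; rewrite mxE cj1 // !mxE.
    by rewrite (inj_eq enum_val_inj).
  - move=> A A' BA BA'; apply/matrixP => i j; rewrite [LHS]mxE cjM // mxE.
    rewrite (bigID (mem C)) /= [X in _ + X]big1 ?addr0 => [|k].
      rewrite big_enum_val mxE; apply: eq_bigr => k _; by rewrite !mxE.
    have := evC i; have := evC j; rewrite !inE => /andP[js _] /andP[ils pis].
    rewrite negb_and !negbK => /orP[ks|pks].
      have [->|nz] := eqVneq (cj A' k (ev j)) 0; first by rewrite mulr0.
      by have /andP[js'] := fs _ _ _ BA' ks nz; rewrite js' in js.
    have [->|nz] := eqVneq (cj A (ev i) k) 0; first by rewrite mul0r.
    have /andP[pis'] := fs _ _ _ (BV _ BA) pks (cjV_neq0 BA nz).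
    by rewrite pis' in pis.
have [m solm] := solB.
have B_1 A : B A -> \det A = 1 by move=> /BSO [].
have [v [v0 hv]] := lie_kolchin gB B_1 conB solm C0 rG.
have [k vk] : exists k, v 0 k != 0.
  apply: contrapT => nk; move/eqP: v0; apply; apply/rowP => k; rewrite mxE.
  by apply/eqP/negPn/negP => vk; apply: nk; exists k.
have vl l : l != k -> v 0 l = 0.
  move=> nlk; apply/eqP/negPn/negP => vl.
  have [c hc] := hv _ (TB (tau_torus (ev k))).
  have ent x : v 0 x * tau_coords (ev k) (ev x) = c * v 0 x.
    have := congr1 (fun M : 'rV[K]_#|C| => M 0 x) hc; rewrite !mxE (bigD1 x) //= big1.
      by rewrite addr0 mxE cj_dm // eqxx.
    move=> y nyx; rewrite mxE cj_dm // (inj_eq enum_val_inj) (negbTE nyx).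
    by rewrite mulr0.
  have ck : c = 2.
    by apply: (mulIf vk); rewrite -ent /tau_coords eqxx mulrC.
  have := ent l; rewrite ck mulrC => /(mulIf vl).
  have nkl : ev l != ev k by rewrite (inj_eq enum_val_inj).
  move=> e; have := tau_coords_sq nkl nkl; rewrite e; by rewrite eqxx.
have key A j : B A -> cj A (ev k) j != 0 -> (j \in s) || (j == ev k).
  move=> BA nz; apply: contraT; rewrite negb_or => /andP[js njk].
  have := evC k; rewrite inE => /andP[ks pks].
  have [pjs|pjs] := boolP (p j \in s).
    have /andP[pks'] := fs _ _ _ (BV _ BA) pjs (cjV_neq0 BA nz).
    by rewrite pks' in pks.
  have jC : j \in C by rewrite inE js.
  have [c hc] := hv _ BA.
  have := congr1 (fun M : 'rV[K]_#|C| => M 0 (enum_rank_in jC j)) hc.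
  rewrite !mxE (bigD1 k) //= big1 => [|l nl]; last by rewrite vl // mul0r.
  rewrite addr0 mxE /ev enum_rankK_in // [in RHS]vl => [/eqP|].
    by rewrite mulr0 mulf_eq0 (negbTE vk) (negbTE nz).
  by apply: contraNneq njk => e; rewrite -e /ev enum_rankK_in.
have := evC k; rewrite inE => /andP[ks pks].
exists (ev k); split.
- by rewrite rcons_uniq ks.
- move=> i; rewrite !mem_rcons !inE => /orP[/eqP ->|ils].
    by rewrite negb_or pks (rev_ord_neq evenN).
  rewrite negb_or ps // andbT; apply: contraNneq pks => <-; by rewrite rev_ordK.
have idx j : j \in s -> index j (rcons s (ev k)) = index j s.
  by move=> js; rewrite -cats1 index_cat js.
have idk : index (ev k) (rcons s (ev k)) = size s.
  by rewrite -cats1 index_cat (negbTE ks) /= eqxx addn0.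
move=> A i j BA; rewrite !mem_rcons !inE => /orP[/eqP ->|ils].
  move=> /(key _ _ BA) /orP[js|/eqP ->]; last by rewrite eqxx leqnn.
  by rewrite js orbT idk idx // ltnW // index_mem.
move=> /(fs _ _ _ BA ils) /andP[js le]; by rewrite js orbT !idx.
Qed.

End BorelFlag.
Section Heights.
Variable s : seq 'I_N.
Hypothesis sizes : size s = n.
Hypothesis uniqs : uniq s.
Hypothesis isos : forall i, i \in s -> p i \notin s.

Lemma half_basis i : (p i \in s) = (i \notin s).
Proof.
apply/idP/idP => [pis|nis]; first by rewrite -(rev_ordK i); apply: isos.
have ut : uniq (s ++ map p s).
  rewrite cat_uniq uniqs map_inj_uniq //; last exact: rev_ord_inj.
  rewrite uniqs andbT; apply/hasPn => _ /mapP [j js ->]; exact: isos.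
have : i \in s ++ map p s.
  have sub : {subset s ++ map p s <= enum 'I_N} by move=> j _; rewrite mem_enum.
  have [|_ ->] := uniq_min_size ut sub; last by rewrite mem_enum.
  by rewrite size_enum_ord size_cat size_map sizes evenN.
rewrite mem_cat (negbTE nis) => /mapP [j js ->]; by rewrite rev_ordK.
Qed.

(** Heights decrease from n to 1 along the flag s; offset 1 gives instead the
    coefficients of the cocharacter on which all simple roots take the value 1. *)
Definition height (e : nat) i : int :=
  if i \in s then (n - index i s - e)%N%:Z else - (n - index (p i) s - e)%N%:Z.

Lemma height_rev e i : height e (p i) = - height e i.
Proof.
rewrite /height half_basis rev_ordK.
by case: (i \in s) => /=; rewrite ?opprK.
Qed.

Lemma index_lt i : i \in s -> (index i s < n)%N.
Proof. by rewrite -index_mem sizes. Qed.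

Lemma index_lt' i : i \notin s -> (index (p i) s < n)%N.
Proof. by move=> nis; apply: index_lt; rewrite half_basis. Qed.

Lemma height_inj : injective (height 0).
Proof.
move=> i j; rewrite /height !subn0.
case: ifPn => hi; case: ifPn => hj e.
- have li := index_lt hi; have lj := index_lt hj.
  have : index i s = index j s by lia.
  by move/(congr1 (nth i s)); rewrite !nth_index.
- have li := index_lt hi; have lj := index_lt' hj; lia.
- have li := index_lt' hi; have lj := index_lt hj; lia.
- have li := index_lt' hi; have lj := index_lt' hj.
  have : index (p i) s = index (p j) s by lia.
  move/(congr1 (nth i s)); rewrite !nth_index ?half_basis //; exact: rev_ord_inj.
Qed.

(** The difference decreases only if i and j lie in opposite halves of the basis, and then
    by 2; it would reach 0 only for the two middle vectors, which p exchanges. *)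
Lemma height1_lt i j : height 0 i < height 0 j -> j != p i -> 1 <= height 1 j - height 1 i.
Proof.
rewrite /height !subn0 => lt njp; move: lt.
case: ifPn => hi; case: ifPn => hj.
- have := index_lt hi; have := index_lt hj; lia.
- have := index_lt hi; have := index_lt' hj; lia.
- have := index_lt' hi; have := index_lt hj => lj li _.
  have : index j s != index (p i) s.
    apply: contraNneq njp => /(congr1 (nth j s)).
    by rewrite !nth_index ?half_basis // => ->.
  lia.
- have := index_lt' hi; have := index_lt' hj; lia.
Qed.

Lemma stable_flag_sub (B : set 'M[K]_N) : B `<=` SOform E -> (forall A, B A -> B (invmx A)) ->
  (forall A i j, B A -> i \in s -> cj A i j != 0 -> (j \in s) && (index j s <= index i s)%N) ->
  B `<=` SOborel (height 0).
Proof.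
move=> BSO BV fs A BA; have SA := BSO _ BA; split=> // i j.
have key A' i' j' : B A' -> i' \in s -> ~~ (height 0 i' <= height 0 j') -> cj A' i' j' = 0.
  move=> BA' i's; apply: contraNeq => /(fs _ _ _ BA' i's) /andP[j's le].
  by rewrite /height i's j's !subn0; lia.
have [iis|nis] := boolP (i \in s); first exact: key.
move=> h; have -> : cj A i j = cj (invmx A) (p j) (p i).
  by rewrite (cj_inv) // !rev_ordK.
have [pjs|npjs] := boolP (p j \in s).
  by apply: key => //; [exact: BV|rewrite !height_rev lerN2].
have jis : j \in s by rewrite -[_ \in _]negbK -half_basis.
by move: h; rewrite /height jis (negbTE nis); lia.
Qed.

Let c := height 0.
Let c_inj : injective c := height_inj.
Let c_rev i : c (p i) = - c i := height_rev 0 i.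

(** For elements of the torus, the quotient of the weights i and j; it is stated as a
    function of all matrices because roots are represented by such functions. *)
Definition ratio i j (t : 'M[K]_N) : K := cj t i i / cj t j j.

(** The sign makes 2 ^ (height 1 j - height 1 i) the weight of root_vector i j, with a
    positive exponent for the roots of the Borel subgroup. *)
Definition theta_coords i : K := 2 ^ (- height 1 i).

Lemma two_unit : (2 : K) != 0. Proof. by rewrite pnatr_eq0. Qed.

Lemma theta_coordsP : torus_coords theta_coords.
Proof.
move=> i; rewrite /theta_coords -expfzDr ?two_unit // height_rev opprK addrC subrr.
exact: expr0z.
Qed.

Lemma two_exp_neq (z : int) : 2 <= z -> (2 : K) ^ z != 2.
Proof.
move=> z2; have [k ->] : exists k : nat, z = k.+2 by exists (`|z| - 2)%N; lia.
rewrite -exprnP -natrX eqr_nat !expnS.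
have : (0 < 2 ^ k)%N by rewrite expn_gt0.
move: (2 ^ k)%N => m; lia.
Qed.

Lemma root_theta (b : 'M[K]_N -> K) : is_root SOtorus (SOborel c) b ->
  exists2 z : int, 1 <= z & b (dm theta_coords) = 2 ^ z.
Proof.
move=> [nt [X rX X0]].
have [i [j nz]] : exists i j, cj X i j != 0.
  apply: contrapT => h; move/eqP: X0; apply; rewrite -(cjK X).
  suff -> : cj X = 0 by rewrite /uncj mulmx0 mul0mx.
  apply/matrixP => i j; rewrite [RHS]mxE; apply/eqP/negPn/negP => nz; apply: h.
  by exists i, j.
have off k : cj X k k = 0 by apply: (root_vector_offdiag) rX nt.
have [LX _] := rX.
have nij : i != j by apply: contraNneq nz => ->; rewrite off.
have njp : j != p i.
  have LX' : mx_Lie (SOform E) X by apply: mx_Lie_sub LX => A [].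
  apply: contraNneq nz => e; have := Lie_form i j LX'.
  rewrite e rev_ordK => h; apply/eqP; move: h; set x := cj X i (p i) => h.
  have : 2 * x = 0 by rewrite mulr_natl mulr2n {1}h addNr.
  by move/eqP; rewrite mulf_eq0 (negbTE two_unit) => /eqP.
have le : c i <= c j by apply/negPn; apply: contraNN nz => h; apply/eqP; apply: Lie_stab LX nij h.
have lt : c i < c j by rewrite lt_neqAle le (inj_eq c_inj) nij.
exists (height 1 j - height 1 i); first exact: height1_lt.
have e := root_space_coords rX theta_coordsP nz.
have tj0 : theta_coords j != 0 by rewrite expfz_neq0 ?two_unit.
apply: (mulIf tj0); rewrite -e /theta_coords -expfzDr ?two_unit //.
by congr (_ ^ _); rewrite addrAC subrr add0r.
Qed.

Lemma ratio_dm i j t : ratio i j (dm t) = t i / t j.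
Proof. by rewrite /ratio !cj_dm // !eqxx. Qed.

(** All roots take values 2^z with z >= 1 on theta (root_theta), so one with the value 2 is
    not a product of two others. *)
Lemma ratio_simple_root i j : j != p i -> c i < c j -> height 1 j - height 1 i = 1 ->
  is_simple_root SOtorus (SOborel c) (ratio i j).
Proof.
move=> njp lt h1; have nij : i != j by apply/eqP => e; rewrite e ltxx in lt.
have rth : ratio i j (dm theta_coords) = 2 ^ 1.
  rewrite ratio_dm /theta_coords invr_expz -expfzDr ?two_unit //.
  by congr (_ ^ _); rewrite opprK addrC.
have Tth := dm_torus theta_coordsP.
split; last first.
  move=> [b [b' [/root_theta [z z1 bz] /root_theta [z' z1' bz'] e]]].
  have := e _ Tth; rewrite rth bz bz' -expfzDr ?two_unit // expr1z => /esym/eqP.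
  by rewrite (negbTE (two_exp_neq _)) //; lia.
split.
  by exists (dm theta_coords) => //; rewrite rth expr1z pnatr_eq1.
exists (root_vector i j).
  split.
    apply: (root_vector_Lie) => //; first exact: ltW.
    by rewrite !c_rev lerN2 ltW.
  move=> t /(torus_dm) [u hu ->].
  by rewrite (root_vector_weight) // ratio_dm.
apply/eqP => z; have := congr1 cj z; rewrite /root_vector uncjK // => /matrixP /(_ i j).
rewrite root_coords_entry !eqxx /= (_ : (i == p j) = false).
  by rewrite subr0 /cj mulmx0 mul0mx mxE => /eqP; rewrite oner_eq0.
by apply: contraNF njp => /eqP ->; rewrite rev_ordK.
Qed.

(** The simple roots of type D_n: the differences of consecutive weights of the flag,
    and the sum of its last two weights. *)
Lemma simple_roots_count : (1 < n)%N -> exists f : 'I_n -> 'M[K]_N -> K,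
  (forall m, is_simple_root SOtorus (SOborel c) (f m)) /\
  (forall m m', (forall t, SOtorus t -> f m t = f m' t) -> m = m').
Proof.
move=> n1; have i0 : 'I_N by exists 0%N; lia.
pose x m := nth i0 s m.
have xs m : (m < n)%N -> x m \in s by move=> mn; rewrite mem_nth ?sizes.
have ix m : (m < n)%N -> index (x m) s = m by move=> mn; rewrite index_uniq ?sizes.
have xI m m' : (m < n)%N -> (m' < n)%N -> (x m == x m') = (m == m').
  by move=> mn mn'; rewrite nth_uniq ?sizes.
have xp m m' : (m < n)%N -> (m' < n)%N -> (x m == p (x m')) = false.
  by move=> mn mn'; apply/eqP => e; have := isos (xs _ mn'); rewrite -e xs.
have px m m' : (m < n)%N -> (m' < n)%N -> (p (x m) == x m') = false.
  by move=> mn mn'; rewrite eq_sym xp.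
have hx e m : (m < n)%N -> height e (x m) = (n - m - e)%N%:Z.
  by move=> mn; rewrite /height xs // ix.
pose f (m : 'I_n) := if (m.+1 < n)%N then ratio (x m.+1) (x m)
                     else ratio (p (x n.-1)) (x n.-2).
have n1n : (n.-1 < n)%N by lia.
have n2n : (n.-2 < n)%N by lia.
exists f; split=> [m|].
  rewrite /f; case: ifP => hm; apply: ratio_simple_root.
  - by rewrite xp.
  - by rewrite /c !hx //; lia.
  - by rewrite !hx //; lia.
  - by rewrite rev_ordK xI //; lia.
  - by rewrite /c height_rev !hx //; lia.
  - by rewrite height_rev !hx //; lia.
(* At tau (x m'), the root m' takes the value 1/2, and the earlier ones 1 or 2. *)
have dist (m m' : 'I_n) : (m < m')%N -> ~ (forall t, SOtorus t -> f m t = f m' t).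
  move=> mm' /(_ _ (tau_torus (x m'))).
  have lm := ltn_ord m; have lm' := ltn_ord m'.
  have mn : (m.+1 < n)%N by lia.
  have h12 : (2 : K)^-1 != 1 by rewrite invr_eq1 pnatr_eq1.
  have h22 : (2 : K)^-1 != 2.
    apply/eqP => e; have := mulVf two_unit; rewrite e -natrM => /eqP; by rewrite (eqr_nat _ 4 1).
  have fm' : f m' (tau (x m')) = 2^-1.
    rewrite /f; case: ifP => hm; rewrite ratio_dm /tau_coords ?rev_ordK.
      by rewrite eqxx !xI // !xp // (_ : (m'.+1 == m' :> nat) = false) ?mul1r //; lia.
    have em : nat_of_ord m' = n.-1 by lia.
    rewrite em px // eqxx xI // xp // (_ : (n.-2 == n.-1) = false) ?divr1 //; lia.
  rewrite fm' /f mn ratio_dm /tau_coords !xI // !xp // (_ : (m == m' :> nat) = false); last by lia.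
  by rewrite divr1; case: ifP => _ /esym/eqP; rewrite ?(negbTE h22) ?(negbTE h12).
move=> m m' e; apply/val_inj; case: (ltngtP m m') => // h; first by case: (dist m m' h).
by case: (dist m' m h) => t Tt; rewrite e.
Qed.

End Heights.

(** Iterating stable_flag_step gives a full isotropic flag of coordinate subspaces stable
    under B. Its stabilizer is connected and solvable, so B equals it by maximality. *)
Lemma Borel_height (B : set 'M[K]_N) : is_Borel B (SOform E) -> SOtorus `<=` B ->
  exists s : seq 'I_N, [/\ size s = n, uniq s, forall i, i \in s -> p i \notin s &
    B = SOborel (height s 0)].
Proof.
move=> [BSO [gB clB conB] solB maxB] TB.
have fcB := zconnected_values clB conB.
have flag m : (m <= n)%N -> exists s, stable_flag B s /\ size s = m.
  elim: m => [|m IHm] mn; first by exists [::]; split.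
  have [|s [fs es]] := IHm; first exact: ltnW.
  have [|i fi] := stable_flag_step gB BSO fcB solB TB fs.
    by rewrite es.
  by exists (rcons s i); rewrite size_rcons es.
have [s [[us ps fs] es]] := flag n (leqnn n).
exists s; split=> //.
have [_ _ _ BV] := gB.
have c_inj := height_inj es us ps.
have c_rev := height_rev es us ps 0.
apply/esym/maxB.
- split; [exact: SOborel_subgroup|exact: SOstab_closed|exact: (SOborel_connected c_inj c_rev)].
- exact: (SOborel_solvable c_inj c_rev).
- by move=> A [].
- exact: (stable_flag_sub es us ps BSO BV fs).
Qed.
End HyperbolicCoordinates.

(** In the hyperbolic basis given by hyperbolic_basis, a maximal torus consists of
    diagonal matrices, hence is the diagonal torus by maximality. *)
Lemma maximal_torus_hyperbolic (K : numClosedFieldType) n N (E : 'M[K]_N) T :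
  N = (n + n)%N -> E \in unitmx -> E^T = E -> is_maximal_torus T (SOform E) ->
  exists Q : 'M[K]_N, [/\ Q \in unitmx, Q *m invmx E *m Q^T = hyperbolic_mx K N &
    T = SOtorus E Q].
Proof.
move=> evenN unitE symE [TSO [[gT clT conT] [Q0 uQ0 dT]] maxT].
have symF : (invmx E)^T = invmx E by rewrite trmx_inv symE.
have unitF : invmx E \in unitmx by rewrite unitmx_inv.
have presF A : T A -> A *m invmx E *m A^T = invmx E.
  by move=> /TSO [_]; apply: SOform_dual.
pose wt i A := cj Q0 A i i.
have wtP i : weight_vector T (row i Q0) (wt i).
  move=> A TA; rewrite -row_mul.
  have -> : Q0 *m A = cj Q0 A *m Q0 by rewrite /cj mulmxKV.
  have /is_diag_mxP dA := dT A TA.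
  apply/rowP => j; rewrite mxE [RHS]mxE [X in _ * X]mxE mxE (bigD1 i) //= big1 ?addr0 //.
  by move=> k nk; rewrite [X in X * _](_ : _ = 0) ?mul0r //; apply: dA; rewrite eq_sym.
have wt_sq i : (forall A, T A -> wt i A ^+ 2 = 1) -> forall A, T A -> wt i A = 1.
  move=> sq A TA; have fc := zconnected_values clT conT.
  have T1 : T 1%:M by case: gT.
  rewrite (fc (wt i) [:: 1; -1] _ _ A 1%:M) //.
  - by rewrite /wt cj1 // mxE eqxx.
  - exact: polymap_cj.
  - move=> B /sq /eqP; rewrite sqrf_eq1 !inE; by [].
have [Q [uQ hQ dQ]] := hyperbolic_basis symF unitF presF uQ0 wtP wt_sq evenN.
exists Q; split=> //; apply/esym/maxT.
- exact: (torus_is_torus evenN unitE uQ hQ).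
- by move=> A [].
- move=> A TA; split; first exact: TSO.
  by have /is_diag_mxP dA := dQ A TA; move=> i j nij; apply: dA.
Qed.

(** * Homomorphisms from SL_2 whose differential squares to zero *)

Section TwoByTwoProducts.
Context (K : fieldType).

Lemma mx2M (a b c d a' b' c' d' : K) : mx2 a b c d *m mx2 a' b' c' d' =
  mx2 (a * a' + b * c') (a * b' + b * d') (c * a' + d * c') (c * b' + d * d').
Proof.
apply/matrixP => i j; rewrite !mxE !big_ord_recl big_ord0 addr0 !mxE /=.
by case: i => [[|[|i]] Hi] //; case: j => [[|[|j]] Hj].
Qed.

Lemma det_mx2 (a b c d : K) : \det (mx2 a b c d) = a * d - b * c.
Proof.
rewrite (expand_det_row _ 0) !big_ord_recl big_ord0 addr0 /cofactor !det_mx11 !mxE /=.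
by rewrite !expr0 /= !mul1r ?expr1 mulN1r mulrN.
Qed.

Lemma mx2_1 : mx2 1 0 0 1 = 1%:M :> 'M[K]_2.
Proof.
apply/matrixP => i j; rewrite !mxE.
by case: i => [[|[|i]] Hi] //; case: j => [[|[|j]] Hj].
Qed.

Lemma eq_mx2 (a b c d a' b' c' d' : K) : a = a' -> b = b' -> c = c' -> d = d' ->
  mx2 a b c d = mx2 a' b' c' d'.
Proof. by move=> -> -> -> ->. Qed.

End TwoByTwoProducts.

Lemma poly_taylor1 (K : comNzRingType) (q : {poly K}) m : exists r : {poly K}, forall h,
  q.[m + h] = q.[m] + h * q^`().[m] + h ^+ 2 * r.[h].
Proof.
elim/poly_ind: q => [|q c [r hr]].
  by exists 0 => h; rewrite deriv0 !horner0 !mulr0 !addr0.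
exists (q^`().[m]%:P + (m%:P + 'X) * r) => h.
rewrite derivD derivM derivX derivC !hornerE hr; ring.
Qed.

Lemma poly_affine (K : numFieldType) (q : {poly K}) :
  q^`()^`() = 0 -> forall s, q.[s] = q.[0] + s * q^`().[0].
Proof.
move=> d2 s; have q2 i : q`_i.+2 = 0.
  have := congr1 (fun r : {poly K} => r`_i) d2; rewrite !coef_deriv coef0 -mulrnA.
  by move/eqP; rewrite mulrn_eq0 => /orP[//|/eqP].
have -> : q = (q`_0)%:P + 'X * (q`_1)%:P.
  apply/polyP => -[|[|i]]; rewrite coefD coefC coefXM coefC /= ?addr0 ?add0r //.
by rewrite derivD derivM derivX !derivC !hornerE; ring.
Qed.

(** A polynomial one-parameter group X satisfies X' = X e, so its second derivative
    X e^2 vanishes and X is affine. *)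
Lemma one_parameter_group (K : numFieldType) N (X : K -> 'M[K]_N)
    (q : 'I_N -> 'I_N -> {poly K}) (e : 'M[K]_N) (r : 'I_N -> 'I_N -> {poly K}) :
  (forall s i j, X s i j = (q i j).[s]) -> (forall s t, X (s + t) = X s *m X t) ->
  (forall s i j, X s i j = (1%:M : 'M[K]_N) i j + s * e i j + s ^+ 2 * (r i j).[s]) ->
  e *m e = 0 -> forall s, X s = 1%:M + s *: e.
Proof.
move=> Xq XD Xr e2.
have X' i j s : (q i j)^`().[s] = (X s *m e) i j.
  have [g hg] := poly_taylor1 (q i j) s.
  apply: (@quadratic_remainder K (q i j).[s] (X s i j) _ _ g (\sum_k (q i k).[s] *: r k j)).
  move=> h; rewrite -hg -Xq XD [LHS]mxE.
  under eq_bigr => k _ do rewrite (Xr h) !mulrDr.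
  rewrite !big_split /=; congr (_ + _ + _).
  - by rewrite -[in RHS](mulmx1 (X s)) [RHS]mxE.
  - by rewrite mxE mulr_sumr; apply: eq_bigr => k _; rewrite mulrCA.
  - by rewrite horner_sum mulr_sumr; apply: eq_bigr => k _; rewrite hornerZ -Xq mulrCA.
have X0 : X 0 = 1%:M by apply/matrixP => i j; rewrite Xr mul0r expr0n mul0r !addr0.
move=> s; apply/matrixP => i j; rewrite Xq poly_affine.
  by rewrite X' X0 mul1mx -Xq X0 [in RHS]mxE [X in _ = _ + X]mxE.
apply: poly_fun_eq0 => t.
have -> : (q i j)^`() = \sum_k q i k * (e k j)%:P.
  apply: poly_fun_eq => u; rewrite X' mxE horner_sum; apply: eq_bigr => k _.
  by rewrite hornerM hornerC Xq.
rewrite linear_sum horner_sum /=.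
transitivity ((X t *m e *m e) i j); last by rewrite -mulmxA e2 mulmx0 mxE.
by rewrite mxE; apply: eq_bigr => k _; rewrite derivM derivC mulr0 addr0 hornerM hornerC X'.
Qed.

Section SL2Triple.
Context (K : numFieldType) (N : nat) (e f : 'M[K]_N).
Hypothesis e2 : e *m e = 0.
Hypothesis f2 : f *m f = 0.

Lemma xyx_expand (a b : 'M[K]_N) t u : t * u = 1 -> a *m a = 0 ->
  (1%:M + t *: a) *m (1%:M - u *: b) *m (1%:M + t *: a) =
  1%:M + (t + t) *: a - u *: b - a *m b - b *m a - t *: (a *m b *m a).
Proof.
move=> tu a2.
have -> : (1%:M + t *: a) *m (1%:M - u *: b) = 1%:M + t *: a - u *: b - a *m b.
  rewrite mulmxBr mulmx1 -scalemxAr mulmxDl mul1mx -scalemxAl scalerDr scalerA.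
  by rewrite (mulrC u) tu scale1r opprD !addrA.
rewrite mulmxDr mulmx1 -scalemxAr !mulmxBl mulmxDl mul1mx -!scalemxAl a2 scaler0 addr0.
rewrite !scalerBr scalerA tu scale1r; move: (a *m b *m a) (a *m b) (b *m a) => aba ab ba.
by apply/matrixP => i j; rewrite !mxE; ring.
Qed.

Hypothesis braid : forall t, t != 0 ->
  (1%:M + t *: e) *m (1%:M - t^-1 *: f) *m (1%:M + t *: e) =
  (1%:M - t^-1 *: f) *m (1%:M + t *: e) *m (1%:M - t^-1 *: f).

(** Both sides of the braid relation are expanded with xyx_expand, and compared. *)
Lemma triple_relation t : t != 0 ->
  t *: e + t^-1 *: f = t *: (e *m f *m e) + t^-1 *: (f *m e *m f).
Proof.
move=> t0; have := braid t0; rewrite (xyx_expand _ (mulfV t0) e2).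
have hV : (- t^-1) * (- t) = 1 by rewrite mulrNN mulVf.
have := xyx_expand e hV f2; rewrite !scaleNr !opprK => ->.
move: (e *m f *m e) (f *m e *m f) (e *m f) (f *m e) => efe fef ef fe /matrixP h.
apply/matrixP => i j; have := h i j; rewrite !mxE => {}h.
apply/eqP; rewrite -subr_eq0; move/eqP: h; rewrite -subr_eq0 => /eqP h.
by apply/eqP; rewrite -[RHS]h; ring.
Qed.

(** Compare triple_relation at t = 1 and t = 2. *)
Lemma efe : e *m f *m e = e.
Proof.
have h2 : (2 : K) != 0 by rewrite pnatr_eq0.
have := triple_relation (oner_neq0 _); have := triple_relation h2; rewrite invr1 !scale1r.
move: (e *m f *m e) (f *m e *m f) => a b /matrixP r2 /matrixP r1.
apply/matrixP => i j; have := r1 i j; have := r2 i j; rewrite !mxE.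
move: (e i j) (f i j) (a i j) (b i j) => x y z w s2 s1.
have h3 : (3 : K) != 0 by rewrite pnatr_eq0.
apply: (mulfI h3).
have -> : 3 * z = 2 * (2 * z + 2^-1 * w) - (z + w) by field.
have -> : 3 * x = 2 * (2 * x + 2^-1 * y) - (x + y) by field.
by rewrite s1 s2.
Qed.

Lemma fef : f *m e *m f = f.
Proof.
have := triple_relation (oner_neq0 _); rewrite invr1 !scale1r efe.
by move/addrI.
Qed.

(** The semisimple element t^h for h = e f - f e: e f and f e are the projections on
    its eigenspaces of eigenvalues t and 1/t. *)
Lemma chi_expand t : t != 0 ->
  (1%:M + t *: e) *m (1%:M - t^-1 *: f) *m (1%:M + t *: e) *m
  ((1%:M - e) *m (1%:M + f) *m (1%:M - e)) =
  1%:M + (t - 1) *: (e *m f) + (t^-1 - 1) *: (f *m e).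
Proof.
move=> t0; rewrite (xyx_expand _ (mulfV t0) e2) efe.
have -> : (1%:M - e) *m (1%:M + f) *m (1%:M - e) = 1%:M - e + f - e *m f - f *m e.
  have hV : (-1 : K) * -1 = 1 by rewrite mulrNN mulr1.
  have := xyx_expand f hV e2; rewrite !scaleN1r opprK efe => ->.
  move: (e *m f) (f *m e) => ef fe.
  by apply/matrixP => i j; rewrite !mxE; ring.
set Z := 1%:M - e *m f - f *m e.
have -> : 1%:M + (t + t) *: e - t^-1 *: f - e *m f - f *m e - t *: e = Z + (t *: e - t^-1 *: f).
  by rewrite /Z; move: (e *m f) (f *m e) => ef fe; apply/matrixP => i j; rewrite !mxE; ring.
have -> : 1%:M - e + f - e *m f - f *m e = Z + (f - e).
  by rewrite /Z; move: (e *m f) (f *m e) => ef fe; apply/matrixP => i j; rewrite !mxE; ring.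
have Ze : Z *m e = 0.
  by rewrite !mulmxBl mul1mx efe subrr -mulmxA e2 mulmx0 subrr.
have Zf : Z *m f = 0.
  by rewrite !mulmxBl mul1mx fef -mulmxA f2 mulmx0 subr0 subrr.
have eZ : e *m Z = 0.
  by rewrite !mulmxBr mulmx1 !mulmxA efe e2 mul0mx subr0 subrr.
have fZ : f *m Z = 0.
  by rewrite !mulmxBr mulmx1 !mulmxA fef subrr f2 mul0mx subrr.
have ZZ : Z *m Z = Z by rewrite {2}/Z !mulmxBr mulmx1 !mulmxA Ze Zf !mul0mx !subr0.
rewrite mulmxDr mulmxDl ZZ mulmxBl -!scalemxAl eZ fZ !scaler0 subrr addr0.
rewrite mulmxDl !mulmxBr Ze Zf subrr add0r !mulmxBl -!scalemxAl e2 f2 /Z.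
rewrite !scaler0.
move: (e *m f) (f *m e) => ef fe; apply/matrixP => i j; rewrite !mxE; ring.
Qed.

(** f is the unique partial inverse of e with projections e f and f e; so if g
    commutes with these and scales e by a, then it scales f by 1/a. *)
Lemma opposite_weight (g : 'M[K]_N) (a : K) : g \in unitmx -> a != 0 ->
  g *m e *m invmx g = a *: e ->
  (forall t, t != 0 -> g *m (1%:M + (t - 1) *: (e *m f) + (t^-1 - 1) *: (f *m e)) =
     (1%:M + (t - 1) *: (e *m f) + (t^-1 - 1) *: (f *m e)) *m g) ->
  g *m f *m invmx g = a^-1 *: f.
Proof.
move=> ug a0 ge com.
have h2 : (2 : K) != 0 by rewrite pnatr_eq0.
have h3 : (3 : K) != 0 by rewrite pnatr_eq0.
(* The values t = 2 and t = 3 separate the two projections. *)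
have [gP gQ] : g *m (e *m f) = (e *m f) *m g /\ g *m (f *m e) = (f *m e) *m g.
  have := com _ h2; have := com _ h3.
  rewrite !(mulmxDr, mulmxDl) -!scalemxAr -!scalemxAl mulmx1 mul1mx.
  move: (g *m (e *m f)) (e *m f *m g) (g *m (f *m e)) (f *m e *m g) => x y z w.
  move=> /matrixP r3 /matrixP r2; split; apply/matrixP => i j.
    have := r3 i j; have := r2 i j; rewrite !mxE.
    move: (x i j) (y i j) (z i j) (w i j) (g i j) => X Y Z W G s2 s3.
    have -> : X = 3 * (G + (3 - 1) * X + (3^-1 - 1) * Z) / 2
      - 2 * (G + (2 - 1) * X + (2^-1 - 1) * Z) + G / 2.
      by field.
    by rewrite s2 s3; field.
  have := r3 i j; have := r2 i j; rewrite !mxE.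
  move: (x i j) (y i j) (z i j) (w i j) (g i j) => X Y Z W G s2 s3.
  have -> : Z = 3 * (G + (3 - 1) * X + (3^-1 - 1) * Z)
    - 6 * (G + (2 - 1) * X + (2^-1 - 1) * Z) + 3 * G.
    by field.
  by rewrite s2 s3; field.
have geE : g *m e = a *: e *m g by rewrite -ge mulmxKV.
have eg : e *m invmx g = a *: (invmx g *m e).
  apply: (can_inj (mulKmx ug)); rewrite mulmxA ge -scalemxAr mulmxA mulmxV // mul1mx //.
pose f0 := a *: (g *m f *m invmx g).
have ef0 : e *m f0 = e *m f.
  rewrite /f0 -scalemxAr !mulmxA scalemxAl scalemxAl scalemxAl -geE.
  by rewrite -(mulmxA g e f) gP mulmxK.
have f0e : f0 *m e = f *m e.
  by rewrite /f0 -scalemxAl -!mulmxA 2!scalemxAr -eg !mulmxA -(mulmxA g f e) gQ mulmxK.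
have f0ef0 : f0 *m e *m f0 = f0.
  rewrite f0e /f0 -scalemxAr; congr (_ *: _).
  by rewrite !mulmxA -gQ -(mulmxA g _ f) fef.
have : f0 = f by rewrite -f0ef0 f0e -mulmxA ef0 mulmxA fef.
by move=> h; rewrite -[in RHS]h scalerA mulVf // scale1r.
Qed.

End SL2Triple.

(** A homomorphism phi from SL_2 to GL_N, given by polynomials and with differential e at
    the standard nilpotent element. *)
Section SL2Morphism.
Context (K : numFieldType) (N : nat) (phi : 'M[K]_2 -> 'M[K]_N) (e : 'M[K]_N).
Hypothesis phi_poly : polymap phi.
Hypothesis phi1 : phi 1%:M = 1%:M.
Hypothesis phiM : forall A B, \det A = 1 -> \det B = 1 -> phi (A *m B) = phi A *m phi B.
Hypothesis phi_tangent : forall a b, exists r : {poly K}, forall t,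
  phi (1%:M + t *: sl2_e) a b = (1%:M : 'M[K]_N) a b + t * e a b + t ^+ 2 * r.[t].
Hypothesis e2 : e *m e = 0.

Definition SL2_sV : 'M[K]_2 := mx2 0 1 (-1) 0.
(** The image of the opposite nilpotent element, as conjugated by the Weyl element. *)
Definition opposite_vector : 'M[K]_N := - (phi SL2_s *m e *m phi SL2_sV).
Local Notation f := opposite_vector.

Lemma det_x s : \det (SL2_x s : 'M[K]_2) = 1.
Proof. by rewrite det_mx2 mulr0 mulr1 subr0. Qed.

Lemma det_y s : \det (SL2_y s : 'M[K]_2) = 1.
Proof. by rewrite det_mx2 mul0r mulr1 subr0. Qed.

Lemma det_s : \det (SL2_s : 'M[K]_2) = 1.
Proof. by rewrite det_mx2 mulr1 mul0r sub0r opprK. Qed.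

Lemma det_sV : \det SL2_sV = 1.
Proof. by rewrite det_mx2 mulrN mulr1 mul0r sub0r opprK. Qed.

Lemma phi_mul3 A B C : \det A = 1 -> \det B = 1 -> \det C = 1 ->
  phi (A *m B *m C) = phi A *m phi B *m phi C.
Proof.
move=> dA dB dC; rewrite phiM ?dC //; last by rewrite det_mulmx dA dB mulr1.
by rewrite phiM.
Qed.

Lemma phi_x s : phi (SL2_x s) = 1%:M + s *: e.
Proof.
have lineE t : SL2_x t = 1%:M + t *: sl2_e :> 'M[K]_2.
  rewrite -mx2_1; apply/matrixP => a b; rewrite !mxE.
  by case: ifP => _; case: ifP => _; rewrite ?mulr0 ?mulr1 ?addr0 ?add0r.
pose gq (a b : 'I_2) : {poly K} := ((1%:M : 'M[K]_2) a b)%:P + 'X * (sl2_e a b)%:P.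
have hq a b : exists q : {poly K}, forall t, phi (SL2_x t) a b = q.[t].
  apply: (polyfun_curve (gam := @SL2_x K) (q := gq) _ (phi_poly a b)) => t u v.
  by rewrite lineE /gq !hornerE mxE [X in _ + X = _]mxE.
have hr a b : exists r : {poly K}, forall t,
    phi (SL2_x t) a b = (1%:M : 'M[K]_N) a b + t * e a b + t ^+ 2 * r.[t].
  by have [r hr] := phi_tangent a b; exists r => t; rewrite lineE.
have hq2 a : exists g : 'I_N -> {poly K}, forall b t, phi (SL2_x t) a b = (g b).[t].
  by have [g hg] := choice (hq a); exists g.
have hr2 a : exists g : 'I_N -> {poly K}, forall b t,
    phi (SL2_x t) a b = (1%:M : 'M[K]_N) a b + t * e a b + t ^+ 2 * (g b).[t].
  by have [g hg] := choice (hr a); exists g.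
have [q hq'] := choice hq2; have [r hr'] := choice hr2.
apply: (one_parameter_group (q := q) (r := r) (X := fun t => phi (SL2_x t))) => //.
move=> t u; rewrite -(phiM (det_x t) (det_x u)) mx2M; congr phi.
by apply: eq_mx2; rewrite ?mulr0 ?mul0r ?mulr1 ?mul1r ?addr0 ?add0r // addrC.
Qed.

Lemma phi_s_sV : phi SL2_s *m phi SL2_sV = 1%:M.
Proof.
rewrite -(phiM det_s det_sV) -phi1; congr phi.
by rewrite -mx2_1 mx2M; apply: eq_mx2; ring.
Qed.

Lemma phi_y s : phi (SL2_y s) = 1%:M + s *: f.
Proof.
have -> : SL2_y s = SL2_s *m SL2_x (- s) *m SL2_sV :> 'M[K]_2.
  by rewrite !mx2M; apply: eq_mx2; ring.
rewrite (phi_mul3 det_s (det_x (- s)) det_sV) phi_x mulmxDr mulmx1 mulmxDl phi_s_sV.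
by rewrite -scalemxAr -scalemxAl /f scalerN scaleNr.
Qed.

Lemma opposite_vector_sq : f *m f = 0.
Proof.
rewrite /f mulNmx mulmxN opprK !mulmxA.
rewrite -(mulmxA _ (phi SL2_sV) (phi SL2_s)) (mulmx1C phi_s_sV).
by rewrite mulmx1 -(mulmxA _ e e) e2 mulmx0 mul0mx.
Qed.

Lemma phi_braid t : t != 0 ->
  (1%:M + t *: e) *m (1%:M - t^-1 *: f) *m (1%:M + t *: e) =
  (1%:M - t^-1 *: f) *m (1%:M + t *: e) *m (1%:M - t^-1 *: f).
Proof.
move=> t0; rewrite -scaleNr -(phi_x t) -(phi_y (- t^-1)).
rewrite -(phi_mul3 (det_x t) (det_y _) (det_x t)) -(phi_mul3 (det_y _) (det_x t) (det_y _)).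
by congr phi; rewrite !mx2M; apply: eq_mx2; field.
Qed.

(** In SL_2, both diag(t, 1/t) and the Weyl element are products of unipotents. *)
Lemma phi_chi t : t != 0 -> phi (SL2_chi t) =
  1%:M + (t - 1) *: (e *m f) + (t^-1 - 1) *: (f *m e).
Proof.
move=> t0; rewrite -(chi_expand e2 opposite_vector_sq phi_braid t0).
have xV : 1%:M - e = phi (SL2_x (-1)) by rewrite phi_x scaleN1r.
have y1 : 1%:M + f = phi (SL2_y 1) by rewrite phi_y scale1r.
rewrite xV y1 -scaleNr -(phi_x t) -(phi_y (- t^-1)).
have d1 : \det (SL2_x t *m SL2_y (- t^-1) *m SL2_x t) = 1.
  by rewrite !det_mulmx (det_x t) (det_y (- t^-1)) !mulr1.
have d2 : \det (SL2_x (-1) *m SL2_y 1 *m SL2_x (-1) : 'M[K]_2) = 1.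
  by rewrite !det_mulmx (det_x (-1)) (det_y 1) !mulr1.
rewrite -(phi_mul3 (det_x t) (det_y _) (det_x t)) -(phi_mul3 (det_x _) (det_y 1) (det_x _)).
by rewrite -(phiM d1 d2); congr phi; rewrite !mx2M; apply: eq_mx2; field.
Qed.

End SL2Morphism.

(** Conjugation by g preserves the trace of e f, and multiplies it by a / b. *)
Lemma trace_weights (K : fieldType) N (e f g : 'M[K]_N) (a b : K) :
  g \in unitmx -> a != b -> b != 0 ->
  g *m e *m invmx g = a *: e -> g *m f *m invmx g = b^-1 *: f -> \tr (e *m f) = 0.
Proof.
move=> ug nab b0 he hf.
have h : \tr (e *m f) = a * b^-1 * \tr (e *m f).
  have -> : a * b^-1 * \tr (e *m f) = \tr (g *m e *m invmx g *m (g *m f *m invmx g)).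
    by rewrite he hf -scalemxAl -scalemxAr !mxtraceZ mulrA.
  by rewrite !mulmxA mulmxKV // [RHS]mxtrace_mulC !mulmxA mulVmx // mul1mx.
apply/eqP; move/eqP: h; rewrite -subr_eq0 -{1}[\tr (e *m f)]mul1r -mulrBl mulf_eq0.
case/orP => //; rewrite subr_eq0 => /eqP h; case/eqP: nab.
by rewrite -[RHS]mul1r h mulfVK.
Qed.

(** * Positive words in the elementary matrices of GL_N *)

Section PositiveWords.
Context (R : realType) (N : nat).
Implicit Types (A B : 'M[R]_N).

Definition mxle A B : Prop := forall i j, A i j <= B i j.

(** If A >= 1 and B >= 1 entrywise, then A B - A = A (B - 1) >= 0, and likewise for B. *)
Lemma mxle_prod m (F : 'I_m -> 'M[R]_N) : (forall j, mxle 1%:M (F j)) ->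
  let P := \big[mulmx/1%:M]_(j < m) F j in mxle 1%:M P /\ forall j, mxle (F j) P.
Proof.
elim: m F => [|m IHm] F hF /=.
  by rewrite big_ord0; split=> [i j|[]].
rewrite big_ord_recl; have [P1 PF] := IHm (fun j => F (lift ord0 j)) (fun j => hF _).
move: (\big[_/_]_(_ < m) _) P1 PF => P P1 PF.
have ge0 A : mxle 1%:M A -> forall i j, 0 <= A i j.
  by move=> hA i j; apply: le_trans (hA i j); rewrite mxE ler0n.
have mono A B : mxle 1%:M A -> mxle 1%:M B -> mxle A (A *m B) /\ mxle B (A *m B).
  move=> hA hB; split=> i j; rewrite -subr_ge0.
    have -> : (A *m B) i j - A i j = (A *m (B - 1%:M)) i j.
      by rewrite mulmxBr mulmx1 [RHS]mxE [X in _ + X = _](_ : _ = (- A) i j) // mxE.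
    rewrite mxE sumr_ge0 // => k _; apply: mulr_ge0; first exact: ge0.
    by rewrite !mxE subr_ge0; have := hB k j; rewrite mxE.
  have -> : (A *m B) i j - B i j = ((A - 1%:M) *m B) i j.
    by rewrite mulmxBl mul1mx [RHS]mxE [X in _ + X = _](_ : _ = (- B) i j) // mxE.
  rewrite mxE sumr_ge0 // => k _; apply: mulr_ge0; last exact: ge0.
  by rewrite !mxE subr_ge0; have := hA i k; rewrite mxE.
have [m1 m2] := mono _ _ (hF ord0) P1.
have tr A B C : mxle A B -> mxle B C -> mxle A C.
  by move=> h h' i j; apply: le_trans (h i j) (h' i j).
split; first exact: tr m1.
by move=> j; case: (unliftP ord0 j) => [j' ->|-> //]; exact: tr (PF j') m2.
Qed.

End PositiveWords.

Section Words.
Context (R : realType) (N : nat).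

Definition letter0 (k : 'I_N.-1) : 'I_N := Ordinal (leq_trans (ltn_ord k) (leq_pred N)).

Lemma letter1_proof (k : 'I_N.-1) : (k.+1 < N)%N.
Proof. by have := ltn_ord k; lia. Qed.

Definition letter1 (k : 'I_N.-1) : 'I_N := Ordinal (letter1_proof k).

Lemma phiA_mx2 (k : 'I_N.-1) (a b : R) :
  phiA k (mx2 1 a b 1) =
  1%:M + a *: delta_mx (letter0 k) (letter1 k) + b *: delta_mx (letter1 k) (letter0 k).
Proof.
apply/matrixP => i j; rewrite !mxE -!val_eqE /=.
have [ik|nik] := boolP (k <= i <= k.+1)%N; have [jk|njk] := boolP (k <= j <= k.+1)%N => /=.
- rewrite !inordK; try lia.
  have kk1 : (nat_of_ord k == k.+1) = false by apply: ltn_eqF.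
  have k1k : (k.+1 == nat_of_ord k) = false by apply: gtn_eqF.
  have [e|e] : nat_of_ord i = k \/ nat_of_ord i = k.+1 by lia.
    have [e'|e'] : nat_of_ord j = k \/ nat_of_ord j = k.+1 by lia.
      by rewrite e e' subnn !eqxx kk1 /= !mulr0 !addr0.
    by rewrite e e' subnn subSnn !eqxx kk1 /= mulr1 mulr0 add0r addr0.
  have [e'|e'] : nat_of_ord j = k \/ nat_of_ord j = k.+1 by lia.
    by rewrite e e' subnn subSnn !eqxx k1k /= mulr0 mulr1 !add0r.
  by rewrite e e' subSnn !eqxx k1k /= !mulr0 !addr0.
- have -> : (nat_of_ord j == k.+1) = false by apply/negbTE; lia.
  have -> : (nat_of_ord j == k) = false by apply/negbTE; lia.
  by rewrite !andbF !mulr0 !addr0.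
- have -> : (nat_of_ord i == k.+1) = false by apply/negbTE; lia.
  have -> : (nat_of_ord i == k) = false by apply/negbTE; lia.
  by rewrite !mulr0 !addr0.
- have -> : (nat_of_ord i == k.+1) = false by apply/negbTE; lia.
  have -> : (nat_of_ord i == k) = false by apply/negbTE; lia.
  by rewrite !mulr0 !addr0.
Qed.

Lemma phiA_x k (a : R) : phiA k (SL2_x a) = 1%:M + a *: delta_mx (letter0 k) (letter1 k).
Proof. by rewrite phiA_mx2 scale0r addr0. Qed.

Lemma phiA_y k (a : R) : phiA k (SL2_y a) = 1%:M + a *: delta_mx (letter1 k) (letter0 k).
Proof. by rewrite phiA_mx2 scale0r addr0. Qed.

Lemma letter_neq k : letter0 k != letter1 k.
Proof. by rewrite -val_eqE /= neq_ltn ltnSn. Qed.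

(** By mxle_prod the word dominates each of its factors. The places u and v cover the words
    in the upper and in the lower elementary matrices at once. *)
Lemma word_positive (g : R -> 'M[R]_2) (u v : 'I_N.-1 -> 'I_N) (s : seq 'I_N.-1)
    (a : 'I_(size s) -> R) :
  (forall k x, phiA k (g x) = 1%:M + x *: delta_mx (u k) (v k)) ->
  (forall k, u k != v k) -> (forall j, 0 < a j) ->
  (forall i j, 0 <= (wordA g a - 1%:M) i j) /\
  (forall k, k \in s -> 0 < (wordA g a - 1%:M) (u k) (v k)).
Proof.
move=> hg uv a0.
pose F j := phiA (tnth (in_tuple s) j) (g (a j)).
have F1 j : mxle 1%:M (F j).
  move=> x y; rewrite /F hg [X in _ <= X]mxE lerDl !mxE.
  by apply: mulr_ge0; rewrite ?ler0n // ltW.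
have [P1 PF] := mxle_prod F1.
split=> [i j|k ks].
  by rewrite mxE [X in _ + X]mxE subr_ge0; apply: P1.
have kt : k \in in_tuple s by [].
have [j ej] := tnthP _ _ kt.
rewrite mxE [X in _ + X]mxE [X in _ - X]mxE (negbTE (uv k)) subr0.
apply: lt_le_trans (PF j (u k) (v k)).
by rewrite /F -ej hg !mxE (negbTE (uv k)) !eqxx add0r mulr1.
Qed.

Lemma word_single k (s : seq 'I_N.-1) (a : 'I_(size s) -> R) :
  (forall k', k' \in s -> k' = k) ->
  exists c, wordA (@SL2_x R) a = 1%:M + c *: delta_mx (letter0 k) (letter1 k).
Proof.
move=> hs; rewrite /wordA; elim/big_ind: _ => [|A B [c ->] [d ->]|j _].
- by exists 0; rewrite scale0r addr0.
- exists (c + d); rewrite mulmxDl mul1mx mulmxDr mulmx1 -scalemxAl -scalemxAr.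
  rewrite mul_delta_mx_cond eq_sym (negbTE (letter_neq k)) mulr0n !scaler0 addr0.
  move: (delta_mx _ _) => D; apply/matrixP => i j; rewrite !mxE; ring.
- exists (a j); rewrite (hs (tnth (in_tuple s) j)) ?phiA_x //.
  exact: (mem_tnth j (in_tuple s)).
Qed.

End Words.

(** Compare the terms of odd degree in s, at s = 1 and s = -1. *)
Lemma isometric_line_skew (K : numFieldType) N (E e : 'M[K]_N) :
  (forall s, (1%:M + s *: e)^T *m E *m (1%:M + s *: e) = E) -> e^T *m E + E *m e = 0.
Proof.
move=> h; pose S := e^T *m E + E *m e.
have expand s : (1%:M + s *: e)^T *m E *m (1%:M + s *: e) = E + s *: S + s ^+ 2 *: (e^T *m E *m e).
  have -> : (1%:M + s *: e)^T = 1%:M + s *: e^T by apply/matrixP => a b; rewrite !mxE eq_sym.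
  rewrite mulmxDr mulmx1 mulmxDl mul1mx -scalemxAl -scalemxAr mulmxDl -scalemxAl.
  by rewrite !scalerDr scalerA -expr2 !addrA.
rewrite -/S; move: S expand => S expand.
have := h 1; have := h (-1); rewrite !expand sqrrN expr1n !scale1r scaleN1r.
move: (e^T *m E *m e) => X /matrixP h1 /matrixP h2; apply/matrixP => a b.
have := h1 a b; have := h2 a b; rewrite !mxE => e2 e1.
have h20 : (2 : K) != 0 by rewrite pnatr_eq0.
apply: (mulfI h20); rewrite mulr0.
have -> : 2 * S a b = (E a b + S a b + X a b) - (E a b - S a b + X a b) by ring.
by rewrite e1 e2 subrr.
Qed.

(** Here E e is skew-symmetric with at most one nonzero column, hence is zero. *)
Lemma skew_single_entry (K : numFieldType) N (E e : 'M[K]_N) (x y : 'I_N) (c : K) :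
  E \in unitmx -> E^T = E -> e = c *: delta_mx x y -> e^T *m E + E *m e = 0 -> e = 0.
Proof.
move=> uE symE he skew; apply: (can_inj (mulKmx uE)); rewrite mulmx0.
set S := E *m e in skew *.
have skS i j : S j i + S i j = 0.
  have -> : S j i = (e^T *m E) i j.
    by rewrite -[in RHS]symE -trmx_mul [RHS]mxE.
  by move/matrixP: skew => /(_ i j); rewrite mxE [RHS]mxE.
have S0 i j : j != y -> S i j = 0.
  move=> nj; rewrite mxE big1 // => k _; rewrite he !mxE (negbTE nj) andbF.
  by rewrite !mulr0.
apply/matrixP => i j; rewrite [RHS]mxE.
have [->|/S0 //] := eqVneq j y.
have [->|/S0 z] := eqVneq i y.
  have /eqP := skS y y; rewrite -mulr2n mulrn_eq0 => /eqP //.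
by have := skS i y; rewrite z add0r.
Qed.

(** Double counting of the pairs (i, k) such that P i k. *)
Lemma disjoint_pairs_card (I J : finType) (P : I -> pred J) :
  (forall i, exists k k', [/\ k != k', P i k & P i k']) ->
  (forall i i' k, P i k -> P i' k -> i = i') -> (#|I| + #|I| <= #|J|)%N.
Proof.
move=> two dis.
have up : (\sum_(i : I) \sum_(k : J) P i k <= #|J|)%N.
  rewrite exchange_big /= -sum1_card; apply: leq_sum => k _.
  have [[i Pik]|none] := pselect (exists i, P i k).
    rewrite (bigD1 i) //= Pik big1 // => i' ni'.
    by case Pi'k: (P i' k) => //; case/eqP: ni'; apply: dis Pi'k Pik.
  by rewrite big1 // => i _; case Pik: (P i k) => //; case: none; exists i.
apply: leq_trans up; rewrite addnn -muln2 -sum_nat_const; apply: leq_sum => i _.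
have [k [k' [nk Pk Pk']]] := two i.
by rewrite (bigD1 k) //= (bigD1 k') /= ?Pk ?Pk' // eq_sym.
Qed.

(** * The homomorphisms of a pinning *)

Section Pinning.
Context (R : realType) (n N : nat) (E : 'M[R]_N) (I : finType) (P : pinning (SO E) I).
Hypothesis evenN : N = (n + n)%N.
Hypothesis unitE : E \in unitmx.
Hypothesis symE : E^T = E.
Local Notation K := (R[i]).
Local Notation rc := (real_complex R).
Local Notation Ec := (map_mx rc E).
Local Notation T := (pin_T P).

Let unitEc : Ec \in unitmx. Proof. by rewrite map_unitmx. Qed.
Let symEc : Ec^T = Ec. Proof. by apply/matrixP => a b; rewrite !mxE -[in RHS]symE mxE. Qed.

Definition phiC i (A : 'M[K]_2) : 'M[K]_N := polymx_eval rc (pin_phi P i) A.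
Definition pin_e i : 'M[K]_N := polymx_diff rc (pin_phi P i) 1%:M sl2_e.
Definition pin_f i : 'M[K]_N := opposite_vector (phiC i) (pin_e i).

Lemma pin_torus_hyperbolic : exists Q : 'M[K]_N, [/\ Q \in unitmx,
  Q *m invmx Ec *m Q^T = hyperbolic_mx K N & T = SOtorus Ec Q].
Proof. by apply: (maximal_torus_hyperbolic evenN) => //; exact: (pin_T_maximal_torus P). Qed.

Lemma pin_root_nontrivial i : exists2 t, T t & pin_root P i t != 1.
Proof. by have [[]] := pin_root_simple P i. Qed.

Lemma pin_e_root i : root_space T (SO E) (pin_root P i) (pin_e i).
Proof. by have [] := pin_phi_e P i. Qed.

Lemma pin_e_neq0 i : pin_e i != 0.
Proof. by have [] := pin_phi_e P i. Qed.

Lemma pin_e_sq i : pin_e i *m pin_e i = 0.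
Proof.
have [Q [uQ hQ eT]] := pin_torus_hyperbolic.
have := pin_e_root i; have := pin_root_nontrivial i; rewrite eT => nt rX.
exact: (root_vector_square evenN unitEc uQ hQ rX nt).
Qed.

Lemma phiC_SO i A : \det A = 1 -> SOform Ec (phiC i A).
Proof. exact: pin_phi_in. Qed.

Lemma phiC_mul i A B : \det A = 1 -> \det B = 1 -> phiC i (A *m B) = phiC i A *m phiC i B.
Proof. exact: pin_phi_mul. Qed.

(** phi(1) is idempotent and invertible. *)
Lemma phiC1 i : phiC i 1%:M = 1%:M.
Proof.
have u : phiC i 1%:M \in unitmx by apply: (@SOform_unit _ _ Ec); apply: phiC_SO; rewrite det1.
by apply: (can_inj (mulKmx u)); rewrite -phiC_mul ?det1 // !mulmx1.
Qed.

Lemma phiC_poly i : polymap (phiC i).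
Proof.
by move=> a b; apply: eq_polyfun (polyfun_eval rc (pin_phi P i a b)) => A; rewrite [RHS]mxE.
Qed.

Lemma phiC_tangent i a b : exists r : {poly K}, forall t,
  phiC i (1%:M + t *: sl2_e) a b = (1%:M : 'M[K]_N) a b + t * pin_e i a b + t ^+ 2 * r.[t].
Proof.
have [r hr] := mxpoly_taylor1 rc (pin_phi P i a b) 1%:M sl2_e.
by exists r => t; rewrite -(phiC1 i) mxE hr [phiC i _ a b]mxE [pin_e i a b]mxE.
Qed.

Lemma phiC_x i s : phiC i (SL2_x s) = 1%:M + s *: pin_e i.
Proof. exact: (phi_x (phiC_poly i) (@phiC_mul i) (phiC_tangent i) (pin_e_sq i)). Qed.

Lemma phiC_y i s : phiC i (SL2_y s) = 1%:M + s *: pin_f i.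
Proof. exact: (phi_y (phiC_poly i) (phiC1 i) (@phiC_mul i) (phiC_tangent i) (pin_e_sq i)). Qed.

Lemma pin_f_sq i : pin_f i *m pin_f i = 0.
Proof. exact: (opposite_vector_sq (phiC1 i) (@phiC_mul i) (pin_e_sq i)). Qed.

Let pin_braid i := phi_braid (phiC_poly i) (phiC1 i) (@phiC_mul i) (phiC_tangent i) (pin_e_sq i).

Lemma phiC_chi i t : t != 0 -> phiC i (SL2_chi t) =
  1%:M + (t - 1) *: (pin_e i *m pin_f i) + (t^-1 - 1) *: (pin_f i *m pin_e i).
Proof.
exact: (phi_chi (phiC_poly i) (phiC1 i) (@phiC_mul i) (phiC_tangent i) (pin_e_sq i)).
Qed.

Lemma pin_root_neq0 i t : T t -> pin_root P i t != 0.
Proof.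
move=> Tt; have [_ /(_ t Tt) h] := pin_e_root i.
have ut : t \in unitmx.
  have [TS _ _] := pin_T_maximal_torus P; exact: (@SOform_unit _ _ Ec _ (TS _ Tt)).
apply: contraNneq (pin_e_neq0 i) => z; move: h; rewrite z scale0r => h.
by rewrite -[pin_e i](mulKmx ut) -[t *m _](mulmxKV ut) h mul0mx mulmx0.
Qed.

(** The images of diag(u, 1/u) lie in the torus, which is commutative. *)
Lemma pin_f_weight i t : T t -> t *m pin_f i *m invmx t = (pin_root P i t)^-1 *: pin_f i.
Proof.
move=> Tt; have [_ /(_ t Tt) h] := pin_e_root i.
have ut : t \in unitmx.
  have [TS _ _] := pin_T_maximal_torus P; exact: (@SOform_unit _ _ Ec _ (TS _ Tt)).
apply: (opposite_weight (pin_e_sq i) (pin_f_sq i) (@pin_braid i) ut (pin_root_neq0 i Tt) h).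
move=> u u0; rewrite -phiC_chi //.
have [Q [uQ hQ eT]] := pin_torus_hyperbolic.
have Tu : T (phiC i (SL2_chi u)) by exact: pin_chiP.
rewrite eT in Tt Tu; exact: (torus_comm unitEc uQ hQ Tt Tu).
Qed.

(** The vectors e_i and f_j have the weights alpha_i and - alpha_j, with alpha_i <> alpha_j. *)
Lemma pin_trace i j : i != j -> \tr (pin_e i *m pin_f j) = 0.
Proof.
move=> nij; have [t Tt nt] : exists2 t, T t & pin_root P i t != pin_root P j t.
  apply: contrapT => h; move/eqP: nij; apply; apply: (@pin_root_inj _ _ _ _ P) => t Tt.
  by apply/eqP/negPn/negP => nt; apply: h; exists t.
have ut : t \in unitmx.
  have [TS _ _] := pin_T_maximal_torus P; exact: (@SOform_unit _ _ Ec _ (TS _ Tt)).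
have [_ /(_ t Tt) he] := pin_e_root i.
exact: (trace_weights ut nt (pin_root_neq0 j Tt) he (pin_f_weight j Tt)).
Qed.

Lemma pin_e_skew i : (pin_e i)^T *m Ec + Ec *m pin_e i = 0.
Proof.
apply: isometric_line_skew => s; rewrite -phiC_x.
by have [_] := phiC_SO i (det_x s).
Qed.

(** The n roots of simple_roots_count are simple roots of the pinning, which are indexed by
    I. *)
Lemma pin_rank : (1 < n)%N -> (n <= #|I|)%N.
Proof.
move=> n1; have [Q [uQ hQ eT]] := pin_torus_hyperbolic.
have TB : SOtorus Ec Q `<=` pin_Bp P by rewrite -eT -(pin_BpBm P) => t [].
have [s [es us ps eB]] := Borel_height evenN unitEc uQ hQ (pin_Bp_Borel P) TB.
have [f [fS finj]] := simple_roots_count evenN unitEc uQ hQ es us ps n1.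
rewrite -eB -eT in fS finj.
have [g hg] := choice (fun m => pin_root_surj (fS m)).
rewrite -{1}(card_ord n); apply: (@leq_card _ _ g) => m m' e.
by apply: finj => t Tt; rewrite hg // e -hg.
Qed.

Lemma phiC_real i (A : 'M[R]_2) : phiC i (map_mx rc A) = map_mx rc (phiR P i A).
Proof.
by apply/matrixP => a b; rewrite !mxE; apply: (mxpoly_eval_map (g := idfun)).
Qed.

End Pinning.

(** * The letters of a positive pinning *)

Section Dagger.
Context (R : realType) (n N : nat) (E : 'M[R]_N) (I : finType) (P : pinning (SO E) I).
Context (psi : I -> seq 'I_N.-1).
Hypothesis evenN : N = (n + n)%N.
Hypothesis unitE : E \in unitmx.
Hypothesis symE : E^T = E.
Hypothesis psi0 : forall i, psi i <> [::].
Hypothesis dag : dagger1 P psi.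
Local Notation K := (R[i]).
Local Notation rc := (real_complex R).

Lemma real_SL2_x (a : R) : map_mx rc (SL2_x a) = SL2_x (rc a).
Proof.
apply/matrixP => i j; rewrite !mxE.
by case: ifP => _; case: ifP => _; rewrite ?rmorph1 ?rmorph0.
Qed.

Lemma real_SL2_y (a : R) : map_mx rc (SL2_y a) = SL2_y (rc a).
Proof.
apply/matrixP => i j; rewrite !mxE.
by case: ifP => _; case: ifP => _; rewrite ?rmorph1 ?rmorph0.
Qed.

Lemma pin_e_real i : pin_e P i = map_mx rc (phiR P i (SL2_x 1) - 1%:M).
Proof.
rewrite map_mxB map_mx1 -phiC_real real_SL2_x (phiC_x P evenN unitE symE) rmorph1.
by rewrite scale1r addrC addKr.
Qed.

Lemma pin_f_real i : pin_f P i = map_mx rc (phiR P i (SL2_y 1) - 1%:M).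
Proof.
rewrite map_mxB map_mx1 -phiC_real real_SL2_y (phiC_y P evenN unitE symE) rmorph1.
by rewrite scale1r addrC addKr.
Qed.

Lemma dagger_e_positive i : let e := phiR P i (SL2_x 1) - 1%:M in
  (forall a b, 0 <= e a b) /\ (forall k, k \in psi i -> 0 < e (letter0 k) (letter1 k)).
Proof.
have [_ _ [f hf fE] _] := dag i; rewrite fE /=.
by apply: word_positive => [k x|k|j]; [exact: phiA_x|exact: letter_neq|exact: (hf j).2].
Qed.

Lemma dagger_f_positive i : let f := phiR P i (SL2_y 1) - 1%:M in
  (forall a b, 0 <= f a b) /\ (forall k, k \in psi i -> 0 < f (letter1 k) (letter0 k)).
Proof.
have [_ [f hf fE] _ _] := dag i; rewrite fE /=.
apply: word_positive => [k x|k|j]; [exact: phiA_y| |exact: (hf j).2].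
by rewrite eq_sym letter_neq.
Qed.

(** The trace of e_i f_j is a sum of nonnegative terms, one of them positive for each
    letter common to psi i and psi j. *)
Lemma dagger_disjoint i j k : k \in psi i -> k \in psi j -> i = j.
Proof.
move=> ki kj; apply/eqP/negPn/negP => nij.
have := pin_trace P evenN unitE symE nij; rewrite pin_e_real pin_f_real -map_mxM trace_map_mx.
have [] := dagger_e_positive i; have [] := dagger_f_positive j.
move: (phiR P i _ - _) (phiR P j _ - _) => e f f0 fp e0 ep /eqP; rewrite fmorph_eq0.
have ef0 a b : 0 <= (e a b) * (f b a) by apply: mulr_ge0.
apply/negP; rewrite gt_eqF // /mxtrace (bigD1 (letter0 k)) //=.
apply: ltr_wpDr; first by rewrite sumr_ge0 // => a _; rewrite mxE sumr_ge0.
rewrite mxE (bigD1 (letter1 k)) //=; apply: ltr_wpDr; first by rewrite sumr_ge0.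
by apply: mulr_gt0; [exact: ep|exact: fp].
Qed.

(** With a single letter, e_i would be a multiple of a matrix unit. *)
Lemma dagger_two_letters i : exists k k', [/\ k != k', k \in psi i & k' \in psi i].
Proof.
case es : (psi i) (psi0 (i := i)) => [//|k s] _.
apply: contrapT => none.
have hs k' : k' \in psi i -> k' = k.
  rewrite es => k's; apply/eqP/negPn/negP => nk; apply: none.
  by exists k', k; rewrite nk mem_head.
have [_ _ [f _ fE] _] := dag i.
have [c hc] := word_single (fun j => f j 1) hs.
have he : pin_e P i = rc c *: delta_mx (letter0 k) (letter1 k).
  rewrite pin_e_real fE hc [1%:M + _]addrC addrK map_mxZ map_delta_mx //.
have uEc : map_mx rc E \in unitmx by rewrite map_unitmx.
have sEc : (map_mx rc E)^T = map_mx rc E.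
  by apply/matrixP => a b; rewrite !mxE -[in RHS]symE mxE.
have := skew_single_entry uEc sEc he (pin_e_skew P evenN unitE symE i).
by move/eqP; rewrite (negbTE (pin_e_neq0 P i)).
Qed.

End Dagger.

Theorem proposition6p1 (R : realType) (n : nat) (hn : (0 < n)%N) :
  ~ exists (E : 'M[R]_(2 * n)) (I : finType) (P : pinning (SO E) I)
      (psi : I -> seq 'I_(2 * n).-1),
    [/\ E \in unitmx, E^T = E, (0 < #|I|)%N,
        (forall i, psi i <> [::]) & dagger1 P psi].
Proof.
move=> [E [I [P [psi [uE sE I0 psi0 dag]]]]].
have evenN : (2 * n = n + n)%N by rewrite mul2n addnn.
have rank : (n <= #|I|)%N.
  have [n1|n1] := ltnP 1 n; first exact: (pin_rank P evenN uE sE n1).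
  by apply: leq_trans I0; lia.
have := disjoint_pairs_card (P := fun i k => k \in psi i)
  (dagger_two_letters evenN uE sE psi0 dag)
  (fun i j k => @dagger_disjoint _ _ _ _ _ _ _ evenN uE sE dag i j k).
by rewrite card_ord; lia.
Qed.
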